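(* The following statements hold: (i) Let $f:\mathbb{R}^n\to\mathbb{R}$ be a polynomial that is convex over $[-1,1]^n$. There exists a family $\{f_\epsilon\}_{\epsilon>0}$ of sos-convex polynomials such that $\|f-f_\epsilon\|_1\to0$ as $\epsilon\to0$. (ii) Let $\rho\in\{-1,0,1\}^n$ and let $f:\mathbb{R}^n\to\mathbb{R}$ be a polynomial that is $\rho$-monotone over $[-1,1]^n$. There exists a family $\{f_\epsilon\}_{\epsilon>0}$ of $\rho$-sos-monotone polynomials such that $\|f-f_\epsilon\|_1\to0$ as $\epsilon\to0$.
   Context: For a polynomial $f$, $\|f\|_1$ is the $\ell_1$-norm of its vector of coefficients; the degrees of the $f_\epsilon$ are allowed to grow. A real polynomial is a sum of squares (sos) if it is a finite sum of squares of real polynomials. A polynomial $p$ is sos-convex if its Hessian $H_p(x)$ is an sos matrix, i.e., $H_p(x)=V(x)^TV(x)$ for some polynomial matrix $V(x)$ (equivalently, $y^TH_p(x)y$ is sos as a polynomial in $(x,y)$). A polynomial $f$ is convex over $[-1,1]^n$ if the convexity inequality holds for all pairs of points of $[-1,1]^n$. A polynomial $f$ is $\rho$-monotone over $[-1,1]^n$ if $\rho_i\frac{\partial f(x)}{\partial x_i}\ge0$ for all $x\in[-1,1]^n$ and $i=1,\ldots,n$; it is $\rho$-sos-monotone if $\rho_i\frac{\partial f(x)}{\partial x_i}$ is sos for $i=1,\ldots,n$. *)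

(* Defs.v *)
From HB Require Import structures.
From mathcomp Require Import all_boot all_order all_algebra.
(* mpoly has to be loaded before the analysis files: their notations clash in
   the other order. *)
From mathcomp Require Import mpoly.
From mathcomp Require Import all_classical all_reals topology normedtype convex.

Set Implicit Arguments.
Unset Strict Implicit.
Unset Printing Implicit Defensive.

Import Order.TTheory GRing.Theory Num.Theory.
Import numFieldNormedType.Exports.

#[global] Open Scope classical_set_scope.
#[global] Open Scope ring_scope.

Definition l1norm (R : realType) (n : nat) (p : {mpoly R[n]}) : R :=
  \sum_(m <- msupp p) `|p@_m|.

Definition sos (R : realType) (n : nat) (p : {mpoly R[n]}) : Prop :=
  exists s : seq {mpoly R[n]}, p = \sum_(q <- s) q ^+ 2.

Definition hessian (R : realType) (n : nat) (p : {mpoly R[n]}) :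
    'M[{mpoly R[n]}]_n :=
  \matrix_(i < n, j < n) (p^`M(i))^`M(j).

(* The factor V need not be square. *)
Definition sos_matrix (R : realType) (n m : nat) (H : 'M[{mpoly R[n]}]_m) :
    Prop :=
  exists (k : nat) (V : 'M[{mpoly R[n]}]_(k, m)), H = V^T *m V.

Definition sos_convex (R : realType) (n : nat) (p : {mpoly R[n]}) : Prop :=
  sos_matrix (hessian p).

Definition cube (R : realType) (n : nat) : set 'rV[R]_n :=
  [set x | forall i : 'I_n, -1 <= x ord0 i <= 1].

Definition convex_on_cube (R : realType) (n : nat) (p : {mpoly R[n]}) : Prop :=
  @convex_function R 'rV[R]_n (@cube R n) (fun x : 'rV[R]_n => p.@[x ord0]).

Definition monotone_on_cube (R : realType) (n : nat) (rho : 'rV[R]_n)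
    (p : {mpoly R[n]}) : Prop :=
  forall x : 'rV[R]_n, cube x ->
  forall i : 'I_n, 0 <= rho ord0 i * (p^`M(i)).@[x ord0].

Definition sos_monotone (R : realType) (n : nat) (rho : 'rV[R]_n)
    (p : {mpoly R[n]}) : Prop :=
  forall i : 'I_n, sos (rho ord0 i *: p^`M(i)).

(* Main.v *)
Require Import Defs.
From HB Require Import structures.
From mathcomp Require Import all_boot all_order all_algebra.
From mathcomp Require Import mpoly.
From mathcomp Require Import all_classical all_reals topology normedtype convex.
From mathcomp Require Import ring lra.

Import Order.TTheory GRing.Theory Num.Theory.
Import numFieldNormedType.Exports.

Set Implicit Arguments.
Unset Strict Implicit.
Unset Printing Implicit Defensive.

(** Write Theta_D for 1 + x_1^(2D) + ... + x_n^(2D) ([even_powers]).  The proof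
    has two independent halves.

    Approximation of nonnegative objects.  If a symmetric polynomial matrix H is
    positive semidefinite on the cube then, for each e > 0 and all large D, the
    matrix H + e Theta_D I is an sos matrix ([sos_matrix_approx]).  The entries
    of H are rewritten exactly in the Bernstein basis of degree N, whose members
    are nonnegative multiples of products of the polynomials 1 + x_i and
    1 - x_i.  As N grows the coefficients approach, uniformly in the index, the
    values of H at the grid points of the cube, so that H + e I is a combination
    of Bernstein polynomials with positive definite constant matrices as
    coefficients, and each of those is a Gram matrix.  It remains to handle a
    single Bernstein polynomial.  The identity behind [sos_addX_even] shows that
    1 + p + p^(2k) / (2k) is a sum of squares, so that 1 + x_i and 1 - x_i are
    limits of sums of squares for the l1-norm; such limits are stable under
    products because the l1-norm is submultiplicative.  Finally a polynomial r
    of degree at most 2D becomes a sum of squares once l1norm r times Theta_D is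
    added to it ([sos_even_powersD]), so that an l1-limit of sums of squares is
    turned into a sum of squares by an arbitrarily small multiple of Theta_D.

    Integrating the perturbation.  The partial derivatives (or the entries of
    the Hessian) of f have to be corrected simultaneously by the derivatives of
    one polynomial h, whose l1-norm has to stay bounded while D grows.  For
    monotonicity, up to the signs of the variables, h is the sum of the x_j and
    of the powers (x_j + t x_i)^(2D+1) and x_i^(2D+1)
    ([monotone_perturbation]).  For convexity, h is the sum of |x|^2 and of the
    powers (x_j^2 + t |x|^2)^(D+1) ([convex_perturbation]).  The small mixing
    parameter t couples the variables, so that each derivative dominates every
    x_j^(2D); taking t of order 1/D keeps the l1-norm bounded, because
    (1 + t)^D then is, while the factor 2D + 1 or D + 1 produced by the
    differentiation compensates for the smallness of t.

    For part (i), [convex_on_cube_hessian] passes from convexity on the cube to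
    a Hessian that is positive semidefinite there; for part (ii), the first half
    is applied to the 1 x 1 matrices formed by the partial derivatives. *)

(** * The l1-norm *)

Section L1norm.
Variables (R : realType) (n : nat).
Implicit Types (p q : {mpoly R[n]}) (m : 'X_{1..n}).

(** Summing over all monomials of bounded degree gives two polynomials a common
    index set, which makes the norm axioms termwise. *)
Lemma l1normwE d p : (msize p <= d)%N ->
  l1norm p = \sum_(m : 'X_{1..n < d}) `|p@_m|.
Proof.
move=> pd; rewrite /l1norm (ssrcomplements.big_mksub 'X_{1..n < d}) /=; last 2 first.
- exact: msupp_uniq.
- by move=> m /msize_mdeg_lt mp; rewrite (leq_trans mp).
rewrite big_mkcond /=; apply: eq_bigr => m _.
by rewrite mcoeff_msupp; case: eqP => //= ->; rewrite normr0.
Qed.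

Lemma l1norm_ge0 p : 0 <= l1norm p.
Proof. by apply: sumr_ge0. Qed.

Lemma l1norm0 : l1norm (0 : {mpoly R[n]}) = 0.
Proof. by rewrite /l1norm msupp0 big_nil. Qed.

Lemma ler_l1normD p q : l1norm (p + q) <= l1norm p + l1norm q.
Proof.
pose d := maxn (msize (p + q)) (maxn (msize p) (msize q)).
rewrite !(@l1normwE d) ?leq_max ?leqnn ?orbT // -big_split /=.
by apply: ler_sum => m _; rewrite mcoeffD ler_normD.
Qed.

Lemma ler_l1norm_sum (I : Type) (r : seq I) (P : pred I) (F : I -> {mpoly R[n]}) :
  l1norm (\sum_(i <- r | P i) F i) <= \sum_(i <- r | P i) l1norm (F i).
Proof.
apply: (big_ind2 (fun p a => l1norm p <= a)) => [|p a q b pa qb|//].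
  by rewrite l1norm0.
by rewrite (le_trans (ler_l1normD _ _)) ?lerD.
Qed.

Lemma l1normZ c p : l1norm (c *: p) = `|c| * l1norm p.
Proof.
pose d := maxn (msize (c *: p)) (msize p).
rewrite !(@l1normwE d) ?leq_max ?leqnn ?orbT // mulr_sumr.
by apply: eq_bigr => m _; rewrite mcoeffZ normrM.
Qed.

Lemma l1normN p : l1norm (- p) = l1norm p.
Proof. by rewrite -scaleN1r l1normZ normrN1 mul1r. Qed.

Lemma l1normX m : l1norm ('X_[m] : {mpoly R[n]}) = 1.
Proof. by rewrite /l1norm msuppX big_seq1 mcoeffX eqxx normr1. Qed.

Lemma l1norm1 : l1norm (1 : {mpoly R[n]}) = 1.
Proof. by rewrite -mpolyX0 l1normX. Qed.

Lemma ler_l1normMX m p : l1norm ('X_[m] * p) <= l1norm p.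
Proof.
rewrite {1}[p]mpolyE mulr_sumr (le_trans (ler_l1norm_sum _ _ _)) //.
rewrite /l1norm; apply: ler_sum => k _.
by rewrite -/(l1norm _) -scalerAr -mpolyXD l1normZ l1normX mulr1.
Qed.

Lemma ler_l1normM p q : l1norm (p * q) <= l1norm p * l1norm q.
Proof.
rewrite {1}[p]mpolyE mulr_suml (le_trans (ler_l1norm_sum _ _ _)) //.
rewrite {2}/l1norm mulr_suml; apply: ler_sum => m _.
by rewrite -scalerAl l1normZ ler_wpM2l ?ler_l1normMX.
Qed.

Lemma ler_l1normXn p k : l1norm (p ^+ k) <= l1norm p ^+ k.
Proof.
elim: k => [|k IHk]; first by rewrite !expr0 l1norm1.
rewrite !exprS (le_trans (ler_l1normM _ _)) //.
by rewrite ler_wpM2l ?l1norm_ge0.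
Qed.

End L1norm.

(** * Sums of squares and sos matrices *)

Section Sos.
Variables (R : realType) (n : nat).
Implicit Types (p q : {mpoly R[n]}).

Lemma sos0 : sos (0 : {mpoly R[n]}).
Proof. by exists [::]; rewrite big_nil. Qed.

Lemma sosD p q : sos p -> sos q -> sos (p + q).
Proof. by move=> [s ->] [t ->]; exists (s ++ t); rewrite big_cat. Qed.

Lemma sos_sum (I : Type) (r : seq I) (P : pred I) (F : I -> {mpoly R[n]}) :
  (forall i, P i -> sos (F i)) -> sos (\sum_(i <- r | P i) F i).
Proof. by move=> sF; apply: big_ind => //; [apply: sos0 | apply: sosD]. Qed.

Lemma sos_sqr p : sos (p ^+ 2).
Proof. by exists [:: p]; rewrite big_seq1. Qed.

Lemma sosM p q : sos p -> sos q -> sos (p * q).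
Proof.
move=> [s ->] [t ->]; rewrite mulr_suml; apply: sos_sum => a _.
rewrite mulr_sumr; apply: sos_sum => b _; rewrite -exprMn; exact: sos_sqr.
Qed.

Lemma sos1 : sos (1 : {mpoly R[n]}).
Proof. by rewrite -(expr1n _ 2); apply: sos_sqr. Qed.

Lemma sosX p k : sos p -> sos (p ^+ k).
Proof.
move=> sp; elim: k => [|k IHk]; first by rewrite expr0; apply: sos1.
by rewrite exprS; apply: sosM.
Qed.

Lemma sosX_even p k : sos (p ^+ (k.*2)).
Proof. by rewrite -muln2 exprM; apply: sos_sqr. Qed.

Lemma sosC (c : R) : 0 <= c -> sos (c%:MP : {mpoly R[n]}).
Proof.
move=> c0; rewrite -(sqr_sqrtr c0) rmorphXn /=; exact: sos_sqr.
Qed.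

Lemma sosZ (c : R) p : 0 <= c -> sos p -> sos (c *: p).
Proof. by move=> c0 sp; rewrite -mul_mpolyC; apply: sosM => //; apply: sosC. Qed.

Lemma sosMn p k : sos p -> sos (p *+ k).
Proof. by move=> sp; rewrite -scaler_nat; apply: sosZ. Qed.

(** In the expansion of (p + q) ^+ k every term except p ^+ k is a product of
    sums of squares. *)
Lemma sosXD_subX p q k : sos p -> sos q -> sos ((p + q) ^+ k - p ^+ k).
Proof.
move=> sp sq; elim: k => [|k IHk]; first by rewrite subrr; apply: sos0.
have -> : (p + q) ^+ k.+1 - p ^+ k.+1 =
  (p + q) * ((p + q) ^+ k - p ^+ k) + q * p ^+ k by rewrite !exprS; ring.
by apply: sosD; apply: sosM => //; [apply: sosD | apply: sosX].
Qed.

(** The weighted arithmetic-geometric mean inequality for p and k copies of q.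
    Writing P_k for this polynomial, P_(k+1) = p P_k + (k+1) q^k (p - q)^2. *)
Lemma sos_agm p q k : sos p -> sos q ->
  sos (p ^+ k.+1 - (p * q ^+ k) *+ k.+1 + q ^+ k.+1 *+ k).
Proof.
move=> sp sq; elim: k => [|k IHk].
  by rewrite expr0 mulr1 expr1 mulr1n mulr0n addr0 subrr; apply: sos0.
have -> : p ^+ k.+2 - (p * q ^+ k.+1) *+ k.+2 + q ^+ k.+2 *+ k.+1 =
  p * (p ^+ k.+1 - (p * q ^+ k) *+ k.+1 + q ^+ k.+1 *+ k)
  + (q ^+ k * (p - q) ^+ 2) *+ k.+1.
  by rewrite !exprS; ring.
apply: sosD; first exact: sosM.
by apply: sosMn; apply: sosM; [apply: sosX | apply: sos_sqr].
Qed.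

End Sos.

Section SosMatrix.
Variables (R : realType) (n m : nat).
Implicit Types (H K : 'M[{mpoly R[n]}]_m) (p : {mpoly R[n]}).

Lemma sos_matrix_gram k (V : 'M[{mpoly R[n]}]_(k, m)) : sos_matrix (V^T *m V).
Proof. by exists k, V. Qed.

Lemma sos_matrix0 : sos_matrix (0 : 'M[{mpoly R[n]}]_m).
Proof. by exists 0%N, 0; rewrite mulmx0. Qed.

Lemma sos_matrixD H K : sos_matrix H -> sos_matrix K -> sos_matrix (H + K).
Proof.
move=> [k [V ->]] [l [W ->]]; exists (k + l)%N, (col_mx V W).
by rewrite tr_col_mx mul_row_col.
Qed.

Lemma sos_matrix_sum (I : Type) (r : seq I) (P : pred I)
    (F : I -> 'M[{mpoly R[n]}]_m) :
  (forall i, P i -> sos_matrix (F i)) -> sos_matrix (\sum_(i <- r | P i) F i).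
Proof.
by move=> sF; apply: big_ind => //; [apply: sos_matrix0 | apply: sos_matrixD].
Qed.

Lemma sos_matrixZ p H : sos p -> sos_matrix H -> sos_matrix (p *: H).
Proof.
move=> [s ->] [k [V ->]]; rewrite scaler_suml; apply: sos_matrix_sum => q _.
exists k, (q *: V); have -> : (q *: V)^T = q *: V^T.
  by apply/matrixP => i j; rewrite !mxE.
by rewrite -scalemxAl -scalemxAr scalerA -expr2.
Qed.

Lemma sos_matrix_scalar p : sos p -> sos_matrix (p%:M : 'M[{mpoly R[n]}]_m).
Proof.
move=> sp; rewrite -[p]mulr1 -scale_scalar_mx; apply: sos_matrixZ => //.
by exists m, 1%:M; rewrite mulmx1 trmx1.
Qed.

End SosMatrix.

(** This is how an approximation theorem for matrices also covers the scalar
    conditions of monotonicity. *)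
Lemma sos_matrix1 (R : realType) (n : nat) (p : {mpoly R[n]}) :
  sos_matrix (p%:M : 'M_1) -> sos p.
Proof.
move=> [k [V]] /matrixP /(_ ord0 ord0); rewrite !mxE eqxx mulr1n => ->.
by apply: sos_sum => i _; rewrite !mxE; apply: sos_sqr.
Qed.
(** * Domination of small polynomials by even powers *)

Section EvenPowers.
Variables (R : realType) (n : nat).
Implicit Types (p q : {mpoly R[n]}) (m : 'X_{1..n}).

Definition even_powers D : {mpoly R[n]} := 1 + \sum_(j < n) 'X_j ^+ D.*2.

Lemma sos_even_powers D : sos (even_powers D).
Proof.
by apply: sosD; [apply: sos1 | apply: sos_sum => j _; apply: sosX_even].
Qed.

(** The arithmetic-geometric mean inequality for a list of sums of squares, with
    an explicit sos certificate: in the inductive step the product of the tail is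
    bounded by its mean, and each resulting term y * z ^+ k is split by
    [sos_agm]. *)
Lemma sos_agm_seq (s : seq {mpoly R[n]}) :
  (forall z, z \in s -> sos z) ->
  sos (\sum_(z <- s) z ^+ size s - (\prod_(z <- s) z) *+ size s).
Proof.
elim: s => [|y s IHs] sos_s; first by rewrite !big_nil subr0; apply: sos0.
have sy : sos y by apply: sos_s; rewrite mem_head.
have ss z : z \in s -> sos z by move=> zs; apply: sos_s; rewrite inE zs orbT.
rewrite !big_cons /=; set k := size s.
have [k0|k0] := posnP k.
  move: k0; rewrite /k => /size0nil -> /=.
  by rewrite !big_nil addr0 mulr1 expr1 subrr; apply: sos0.
pose P := \prod_(z <- s) z; rewrite -/P.
have -> : y ^+ k.+1 + \sum_(z <- s) z ^+ k.+1 - (y * P) *+ k.+1 =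
   k%:R^-1 *: ((y * (\sum_(z <- s) z ^+ k - P *+ k)) *+ k.+1
     + \sum_(z <- s) (y ^+ k.+1 - (y * z ^+ k) *+ k.+1 + z ^+ k.+1 *+ k)).
  rewrite big_split /= sumrB !sumrMnl -mulr_sumr.
  rewrite big_const_seq count_predT iter_addr_0 -/k.
  have -> : forall A B C : {mpoly R[n]},
     (y * (A - P *+ k)) *+ k.+1 + (B *+ k - (y * A) *+ k.+1 + C *+ k) =
     (B + C - (y * P) *+ k.+1) *+ k by move=> A B C; ring.
  by rewrite -[X in _ = _ *: X]scaler_nat scalerA mulVf ?scale1r // pnatr_eq0 -lt0n.
apply: sosZ; first by rewrite invr_ge0.
apply: sosD; first by apply: sosMn; apply: sosM => //; apply: IHs.
rewrite big_seq; apply: sos_sum => z /ss sz; exact: sos_agm.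
Qed.

(** The squares x_j^2 for j in s, padded with ones to a list of length D, satisfy
    the arithmetic-geometric mean inequality, and the D-th power of each of them
    is a term of [even_powers D]. *)
Lemma sos_even_powersB_sqr D (s : seq 'I_n) : (size s <= D)%N ->
  sos (even_powers D - (\prod_(j <- s) 'X_j) ^+ 2).
Proof.
move=> sD; have [D0|D0] := posnP D.
  move: sD; rewrite D0 leqn0 => /nilP ->; rewrite big_nil expr1n.
  rewrite /even_powers addrC addKr; apply: sos_sum => j _; exact: sosX_even.
pose L := nseq (D - size s) (1 : {mpoly R[n]}) ++ [seq 'X_j ^+ 2 | j <- s].
have sL : size L = D by rewrite size_cat size_nseq size_map subnK.
have sosL z : z \in L -> sos z.
  rewrite mem_cat => /orP[/nseqP[-> _]|/mapP[j _ ->]]; first exact: sos1.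
  exact: sos_sqr.
have powL z : z \in L -> sos (even_powers D - z ^+ D).
  rewrite mem_cat => /orP[/nseqP[-> _]|/mapP[j _ ->]].
    rewrite /even_powers expr1n addrC addKr.
    by apply: sos_sum => j _; apply: sosX_even.
  rewrite /even_powers (bigD1 j) //=.
  rewrite -exprM mul2n addrCA [X in sos X]addrC addKr.
  apply: sosD; first exact: sos1.
  by apply: sos_sum => i _; apply: sosX_even.
have prodL : \prod_(z <- L) z = (\prod_(j <- s) 'X_j) ^+ 2.
  by rewrite big_cat /= big_nseq iter_fix ?mul1r// big_map prodrXl.
have := sos_agm_seq sosL; rewrite sL prodL => agm.
have dom : sos (even_powers D *+ D - \sum_(z <- L) z ^+ D).
  rewrite -{2}sL -iter_addr_0 -(count_predT L) -big_const_seq -sumrB.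
  by rewrite big_seq; apply: sos_sum => z /powL.
have := sosD dom agm; rewrite addrA subrK -mulrnBl => /(@sosZ _ _ D%:R^-1).
rewrite invr_ge0 ler0n => /(_ isT).
by rewrite -[X in _ *: X]scaler_nat scalerA mulVf ?scale1r // pnatr_eq0 -lt0n.
Qed.

Lemma mpolyX_prodU m :
  exists2 s : seq 'I_n, size s = mdeg m & 'X_[m] = \prod_(j <- s) 'X_j :> {mpoly R[n]}.
Proof.
exists (flatten [seq nseq (m j) j | j <- enum 'I_n]).
  rewrite size_flatten /shape -map_comp sumnE big_map big_enum /=.
  by rewrite mdegE; apply: eq_bigr => j _; rewrite /= size_nseq.
rewrite big_flatten big_map big_enum /= mpolyXE_id; apply: eq_bigr => j _.
by rewrite big_nseq -Monoid.iteropE.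
Qed.

(** A monomial of degree at most 2D is a product p * q of two monomials of degree
    at most D, and p^2 + q^2 + 2 e p q is a square when e = 1 or e = -1. *)
Lemma sos_even_powersD_monomial D m (e : R) : (mdeg m <= D.*2)%N -> `|e| = 1 ->
  sos (even_powers D + e *: 'X_[m]).
Proof.
move=> mD e1; have [s sm ->] := mpolyX_prodU m.
rewrite -(cat_take_drop D s) big_cat /=.
set p := \prod_(j <- take D s) _; set q := \prod_(j <- drop D s) _.
have sp : sos (even_powers D - p ^+ 2).
  by apply: sos_even_powersB_sqr; rewrite size_take_min geq_minl.
have sq : sos (even_powers D - q ^+ 2).
  by apply: sos_even_powersB_sqr; rewrite size_drop leq_subLR addnn sm.
have -> : even_powers D + e *: (p * q) =
    2^-1 *: ((even_powers D - p ^+ 2) + (even_powers D - q ^+ 2)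
            + (p + e *: q) ^+ 2).
  have -> : (p + e *: q) ^+ 2 = p ^+ 2 + q ^+ 2 + (e *: (p * q)) *+ 2.
    rewrite sqrrD exprZn -real_normK ?num_real// e1 expr1n scale1r -scalerAr.
    by rewrite addrAC.
  have -> : forall A B C E : {mpoly R[n]}, A - B + (A - C) + (B + C + E *+ 2) =
     (A + E) *+ 2 by move=> A B C E; ring.
  by rewrite -[X in _ = _ *: X]scaler_nat scalerA mulVf ?scale1r // pnatr_eq0.
apply: sosZ; first by rewrite invr_ge0.
by apply: sosD; [apply: sosD | apply: sos_sqr].
Qed.

(** The constant in front of [even_powers D] does not depend on D: this is what
    makes l1-small errors harmless whatever their degree. *)
Lemma sos_even_powersD D p (c : R) : (msize p <= D.*2.+1)%N -> l1norm p <= c ->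
  sos (c *: even_powers D + p).
Proof.
move=> pD pc; rewrite -(subrK (l1norm p) c) scalerDl -addrA.
apply: sosD; first by apply: sosZ; [rewrite subr_ge0 | apply: sos_even_powers].
rewrite {2}[p]mpolyE /l1norm scaler_suml -big_split /= big_seq.
apply: sos_sum => m /msize_mdeg_lt mp.
have mD : (mdeg m <= D.*2)%N by rewrite -ltnS (leq_trans mp).
have [->|pm0] := eqVneq p@_m 0.
  by rewrite normr0 !scale0r addr0; apply: sos0.
rewrite {2}[p@_m]numEsg mulrC -scalerA -scalerDr.
apply: sosZ => //; apply: sos_even_powersD_monomial => //.
by rewrite normr_sg pm0.
Qed.

(** * Limits of sums of squares *)

Definition sos_limit p :=
  forall e : R, 0 < e -> exists2 s, sos s & l1norm (p - s) <= e.

Lemma sos_limit_sos p : sos p -> sos_limit p.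
Proof. by move=> sp e /ltW e0; exists p; rewrite // subrr l1norm0. Qed.

Lemma sos_limitM p q : sos_limit p -> sos_limit q -> sos_limit (p * q).
Proof.
have split_le a b (e : R) : 0 <= a -> 0 < e -> b <= e / 2 / (a + 1) ->
    a * b <= e / 2.
  move=> a0 e0; rewrite ler_pdivlMr ?ltr_wpDl// => be.
  have [b0|/ltW b0] := leP b 0; nra.
have pos a (e : R) : 0 <= a -> 0 < e -> 0 < e / 2 / (a + 1).
  by move=> a0 e0; rewrite !divr_gt0 // ltr_wpDl.
move=> lp lq e e0.
have [t st qt] := lq _ (pos _ _ (l1norm_ge0 p) e0).
have [s ss ps] := lp _ (pos _ _ (l1norm_ge0 t) e0).
exists (s * t); first exact: sosM.
have -> : p * q - s * t = p * (q - t) + t * (p - s) by ring.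
rewrite (le_trans (ler_l1normD _ _)) // [leRHS]splitr lerD //.
  by rewrite (le_trans (ler_l1normM _ _)) // split_le ?l1norm_ge0.
by rewrite (le_trans (ler_l1normM _ _)) // split_le ?l1norm_ge0.
Qed.

Lemma sos_limit_prod (I : Type) (r : seq I) (P : pred I)
    (F : I -> {mpoly R[n]}) :
  (forall i, P i -> sos_limit (F i)) -> sos_limit (\prod_(i <- r | P i) F i).
Proof.
move=> lF; apply: big_ind => //; [|exact: sos_limitM].
apply: sos_limit_sos; exact: sos1.
Qed.

Lemma sos_limitX p k : sos_limit p -> sos_limit (p ^+ k).
Proof.
by move=> lp; rewrite -[k]card_ord -prodr_const; apply: sos_limit_prod.
Qed.

(** With d = k + 1 and w = p^2, the polynomial is the sum of
    (w^d - d w + d - 1) / (2d), which is an instance of [sos_agm], of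
    (1 + p)^2 / 2 and of 1 / (2d). *)
Lemma sos_addX_even p k :
  sos (1 + p + (k.+1.*2%:R^-1 : R) *: p ^+ k.+1.*2).
Proof.
pose c := (k.+1.*2%:R^-1 : R)%R; rewrite -/c.
have -> : 1 + p + c *: p ^+ k.+1.*2 =
   c *: ((p ^+ 2) ^+ k.+1 - (p ^+ 2 * 1 ^+ k) *+ k.+1 + 1 ^+ k.+1 *+ k)
   + (2^-1 : R) *: (1 + p) ^+ 2 + c *: 1.
  rewrite -!mul_mpolyC; set C := c%:MP; set h := (2^-1)%:MP.
  have h2 : h *+ 2 = 1.
    by rewrite -raddfMn /= (_ : 2^-1 *+ 2 = 1 :> R) //; field.
  have Ch : C *+ k.+1 = h.
    rewrite /C /h -raddfMn /=; congr (_%:MP).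
    by rewrite /c -(mulr_natr _ k.+1) -muln2 natrM; field; rewrite addrC natr1 pnatr_eq0.
  rewrite !expr1n mulr1 -exprM mul2n; set P := p ^+ _.
  transitivity (C * P + (h - C *+ k.+1) * p ^+ 2 + (C *+ k.+1 - h)
    + h *+ 2 * (1 + p)); last by ring.
  by rewrite h2 Ch subrr mul0r; ring.
apply: sosD; first apply: sosD.
- apply: sosZ; first by rewrite invr_ge0.
  by apply: sos_agm; [apply: sos_sqr | apply: sos1].
- by apply: sosZ; [rewrite invr_ge0 | apply: sos_sqr].
- by apply: sosZ; [rewrite invr_ge0 | apply: sos1].
Qed.

(** The error term p^(2d) / (2d) of [sos_addX_even] has l1-norm at most
    1 / (2d). *)
Lemma sos_limit1D p : l1norm p <= 1 -> sos_limit (1 + p).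
Proof.
move=> p1 e e0; pose k := Num.bound e^-1.
exists (1 + p + (k.+1.*2%:R^-1 : R) *: p ^+ k.+1.*2).
  exact: sos_addX_even.
rewrite opprD addrA subrr sub0r l1normN l1normZ ger0_norm ?invr_ge0//.
rewrite (@le_trans _ _ (k.+1.*2%:R^-1 * 1)) //.
  rewrite ler_wpM2l ?invr_ge0 // (le_trans (ler_l1normXn _ _)) //.
  by rewrite exprn_ile1 // l1norm_ge0.
rewrite mulr1 invf_ple ?posrE ?ltr0n// (le_trans (ltW (archi_boundP _))) //.
  by rewrite invr_ge0 ltW.
by rewrite ler_nat -/k -addnn addSn ltnW // ltnS -{1}[k]addn0 leq_add.
Qed.

Lemma sos_limitD_even_powers p (e : R) : sos_limit p -> 0 < e ->
  exists D0, forall D, (D0 <= D)%N -> sos (p + e *: even_powers D).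
Proof.
move=> lp e0; have [s ss ps] := lp _ e0.
exists (msize (p - s)) => D sD.
rewrite -[p](subrK s) addrAC [_ + e *: _]addrC.
apply: sosD => //; apply: sos_even_powersD => //.
by rewrite (leq_trans sD) // ltnW // ltnS -addnn leq_addr.
Qed.

End EvenPowers.

(** * Bernstein coefficients on the cube *)

Section Bernstein.
Variables (R : realType).

(** Up to the factor N ^_ a, the falling factorials k ^_ a are the coefficients
    of u ^+ a in the Bernstein basis of degree N.  The induction removes one
    factor u by the absorption identity of binomial coefficients. *)
Lemma bernstein_ffact (A : comNzRingType) (u v : A) N a : u + v = 1 ->
  \sum_(k < N.+1) ((k ^_ a * 'C(N, k))%N%:R * (u ^+ k * v ^+ (N - k))) =
  (N ^_ a)%:R * u ^+ a.
Proof.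
move=> uv; elim: a N => [|a IHa] N.
  rewrite ffactn0 mul1r expr0 -[RHS](expr1n A N) -[in RHS]uv [in RHS]addrC exprDn.
  by apply: eq_bigr => k _; rewrite ffactn0 mul1n mulr_natl mulrC.
case: N => [|N]; first by rewrite big_ord1 !ffact0n !mul0r.
rewrite big_ord_recl ffact0n mul0n mul0r add0r ffactSS natrM exprSr.
rewrite -mulrA [_ * (_ * u)]mulrA -IHa mulr_suml mulr_sumr.
apply: eq_bigr => k _; rewrite /= /bump leq0n add1n ffactSS subSS exprSr.
rewrite mulnAC -mul_bin_diag !natrM; ring.
Qed.

Lemma prodr_itv01 (I : Type) (r : seq I) (F : I -> R) :
  (forall i, 0 <= F i <= 1) -> 0 <= \prod_(i <- r) F i <= 1.
Proof.
move=> F01; apply/andP; split; first by apply: prodr_ge0 => i _; case/andP: (F01 i).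
by apply: prodr_ile1 => i _; apply: F01.
Qed.

(** Replacing the factors one at a time: the remaining factors lie in the unit
    interval, so each replacement costs at most the distance of the factors. *)
Lemma ler_norm_prodB (I : Type) (r : seq I) (F G : I -> R) :
  (forall i, 0 <= F i <= 1) -> (forall i, 0 <= G i <= 1) ->
  `|\prod_(i <- r) F i - \prod_(i <- r) G i| <= \sum_(i <- r) `|F i - G i|.
Proof.
move=> F01 G01; elim: r => [|i r IHr]; first by rewrite !big_nil subrr normr0.
rewrite !big_cons; set P := \prod_(j <- r) F j; set Q := \prod_(j <- r) G j.
have -> : F i * P - G i * Q = (F i - G i) * P + G i * (P - Q) by ring.
have P01 : 0 <= P <= 1 by apply: prodr_itv01.
rewrite (le_trans (ler_normD _ _)) // !normrM lerD //.
  by rewrite ler_piMr // ger0_norm; case/andP: P01.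
rewrite (le_trans _ IHr) // ler_piMl // ger0_norm; by case/andP: (G01 i).
Qed.

Lemma ler_norm_ffact_ratio (k N j d : nat) : (k <= N)%N -> (j <= d)%N -> (d < N)%N ->
  `|(k - j)%N%:R / (N - j)%N%:R - k%:R / N%:R| <= d%:R / (N - d)%N%:R :> R.
Proof.
move=> kN jd dN; have jN : (j < N)%N by apply: leq_ltn_trans dN.
have N0 : 0 < N%:R :> R by rewrite ltr0n (leq_trans _ dN).
have Nj0 : 0 < (N - j)%N%:R :> R by rewrite ltr0n subn_gt0.
have Nd0 : 0 < (N - d)%N%:R :> R by rewrite ltr0n subn_gt0.
apply: (@le_trans _ _ (j%:R / (N - j)%N%:R)); last first.
  rewrite ler_pM ?ler_nat ?invr_ge0 ?ler0n// lef_pV2 ?posrE//.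
  by rewrite ler_nat leq_sub2l.
have [kj|jk] := leqP k j.
  move: kj; rewrite -subn_eq0 => /eqP kj; rewrite kj mul0r sub0r normrN.
  rewrite ger0_norm ?divr_ge0// ler_pM ?invr_ge0 ?ler_nat//.
    by rewrite -subn_eq0 kj.
  by rewrite lef_pV2 ?posrE// ler_nat leq_subr.
rewrite !natrB ?(ltnW jk) ?(ltnW jN) //.
rewrite !natrB ?(ltnW jN) // in Nj0.
have -> : (k%:R - j%:R) / (N%:R - j%:R) - k%:R / N%:R =
   - (j%:R * (N%:R - k%:R) / (N%:R * (N%:R - j%:R))) :> R.
  by field; rewrite ?gt_eqF.
have kNR : k%:R <= N%:R :> R by rewrite ler_nat.
rewrite normrN ger0_norm; last first.
  by rewrite divr_ge0 ?mulr_ge0 ?subr_ge0 ?ler0n// ltW // -subr_gt0.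
rewrite -mulrA ler_wpM2l // invfM mulrA ler_piMl ?invr_ge0 ?(ltW Nj0) //.
by rewrite ler_pdivrMr // mul1r gerBl.
Qed.

End Bernstein.

Section BernsteinCube.
Variables (R : realType) (n : nat).
Implicit Types (p : {mpoly R[n]}).

(** The affine change of variables between the cube and the unit cube, on which
    the Bernstein basis is simplest. *)
Definition to_unit : n.-tuple {mpoly R[n]} := [tuple 2 *: 'X_i - 1 | i < n].
Definition of_unit : n.-tuple {mpoly R[n]} := [tuple 2^-1 *: (1 + 'X_i) | i < n].

Lemma comp_to_unitK p : (p \mPo to_unit) \mPo of_unit = p.
Proof.
elim/mpolyind: p => [|c m p _ _ IHp]; first by rewrite !comp_mpoly0.
rewrite !comp_mpolyD IHp !comp_mpolyZ; congr (_ *: _ + _).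
rewrite comp_mpolyX rmorph_prod /= [RHS]mpolyXE_id; apply: eq_bigr => i _.
rewrite rmorphXn /= tnth_mktuple; congr (_ ^+ _).
rewrite comp_mpolyB comp_mpolyZ comp_mpoly1 comp_mpolyXU -tnth_nth tnth_mktuple.
by rewrite scalerA mulfV ?scale1r ?pnatr_eq0// addrC addKr.
Qed.

Definition bernstein N (k : {ffun 'I_n -> 'I_N.+1}) : {mpoly R[n]} :=
  \prod_(i < n) ('C(N, k i)%:R *
    ((2^-1 *: (1 + 'X_i)) ^+ k i * (2^-1 *: (1 - 'X_i)) ^+ (N - k i))).

Definition bernstein_node N (k : {ffun 'I_n -> 'I_N.+1}) : 'rV[R]_n :=
  \row_i (2 * ((k i)%:R / N%:R) - 1).

(** The exact coefficients of p in the Bernstein basis, not the values at the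
    nodes that Bernstein's approximation operator uses. *)
Definition bernstein_coef N p (k : {ffun 'I_n -> 'I_N.+1}) : R :=
  \sum_(m <- msupp (p \mPo to_unit)) (p \mPo to_unit)@_m *
    \prod_(i < n) ((k i ^_ m i)%:R / (N ^_ m i)%:R).

Lemma cube_bernstein_node N (k : {ffun 'I_n -> 'I_N.+1}) :
  (0 < N)%N -> cube (bernstein_node k).
Proof.
move=> N0 i; rewrite !mxE.
have k0 : 0 <= (k i)%:R / N%:R :> R by rewrite divr_ge0.
have k1 : (k i)%:R / N%:R <= 1 :> R.
  by rewrite ler_pdivrMr ?ltr0n// mul1r ler_nat -ltnS.
by apply/andP; split; lra.
Qed.

Lemma bernstein_monomial N (m : 'X_{1..n}) : (mdeg m <= N)%N ->
  'X_[m] \mPo of_unit =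
  \sum_(k : {ffun 'I_n -> 'I_N.+1})
    (\prod_(i < n) ((k i ^_ m i)%:R / (N ^_ m i)%:R)) *: bernstein k.
Proof.
move=> mN; rewrite comp_mpolyX.
transitivity (\prod_(i < n) \sum_(j < N.+1) ((j ^_ m i)%:R / (N ^_ m i)%:R) *:
   ('C(N, j)%:R * ((2^-1 *: (1 + 'X_i)) ^+ j * (2^-1 *: (1 - 'X_i)) ^+ (N - j)))
   : {mpoly R[n]}).
  apply: eq_bigr => i _; rewrite tnth_mktuple.
  set u : {mpoly R[n]} := _ *: (1 + _); set v : {mpoly R[n]} := _ *: (1 - _).
  have uv : u + v = 1.
    rewrite /u /v !scalerDr scalerN addrACA subrr addr0 -scalerDl -[RHS]scale1r.
    by congr (_ *: _); field.
  have miN : (m i <= N)%N.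
    by rewrite (leq_trans _ mN) // mdegE (bigD1 i) //= leq_addr.
  have N0 : (N ^_ m i)%:R != 0 :> R by rewrite pnatr_eq0 -lt0n ffact_gt0.
  apply: (@scalerI _ _ ((N ^_ m i)%:R : R)) => //.
  rewrite scaler_nat -[LHS]mulr_natl -(bernstein_ffact _ _ uv) scaler_sumr.
  apply: eq_bigr => j _; rewrite scalerA [(N ^_ _)%:R * _]mulrC divfK // scaler_nat.
  by rewrite natrM -mulrA mulr_natl.
rewrite bigA_distr_bigA /=; apply: eq_bigr => k _.
by rewrite scaler_prod.
Qed.

Lemma bernsteinE N p : (msize (p \mPo to_unit) <= N)%N ->
  p = \sum_(k : {ffun 'I_n -> 'I_N.+1}) bernstein_coef p k *: bernstein k.
Proof.
move=> pN; rewrite -{1}[p]comp_to_unitK {1}[p \mPo to_unit]mpolyE raddf_sum /=.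
under [RHS]eq_bigr do rewrite /bernstein_coef scaler_suml.
rewrite exchange_big /= big_seq [RHS]big_seq; apply: eq_bigr => m mp.
rewrite comp_mpolyZ (@bernstein_monomial N); last first.
  by rewrite -ltnS (leq_trans (msize_mdeg_lt mp)) // (leq_trans pN).
by rewrite scaler_sumr; apply: eq_bigr => k _; rewrite scalerA.
Qed.

Lemma sum_bernstein N : \sum_(k : {ffun 'I_n -> 'I_N.+1}) bernstein k = 1.
Proof.
have := @bernstein_monomial N 0; rewrite mdeg0 mpolyX0 comp_mpoly1 => /(_ isT) ->.
by apply: eq_bigr => k _; rewrite big1 ?scale1r // => i _; rewrite mnm0E divr1.
Qed.

(** The coefficient and the value at the node differ by replacing each factor
    (k - j) / (N - j) of a ratio of falling factorials by k / N, in products of at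
    most d factors. *)
Lemma bernstein_coef_dist N d p (k : {ffun 'I_n -> 'I_N.+1}) :
  (msize (p \mPo to_unit) <= d)%N -> (d < N)%N ->
  `|bernstein_coef p k - p.@[bernstein_node k ord0]| <=
  l1norm (p \mPo to_unit) * (d%:R * (d%:R / (N - d)%N%:R)).
Proof.
move=> pd dN; set g := p \mPo to_unit.
have -> : p.@[bernstein_node k ord0] = g.@[fun i => (k i)%:R / N%:R].
  rewrite comp_mpoly_meval; apply: meval_eq => i.
  by rewrite tnth_mktuple mevalB mevalZ mevalXU meval1 !mxE.
rewrite mevalE /bernstein_coef -/g -sumrB (le_trans (ler_norm_sum _ _ _)) //.
rewrite mulr_suml big_seq [leRHS]big_seq; apply: ler_sum => m mg.
rewrite -mulrBr normrM ler_wpM2l //.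
have md : (mdeg m <= d)%N by rewrite ltnW // (leq_trans (msize_mdeg_lt mg)).
have mid i : (m i <= d)%N.
  by rewrite (leq_trans _ md) // mdegE (bigD1 i) //= leq_addr.
have kN i : (k i <= N)%N by rewrite -ltnS.
have N0 : 0 < N%:R :> R by rewrite ltr0n (leq_trans _ dN).
have ratio01 (j l : nat) : (j <= l)%N -> 0 <= (j%:R / l%:R : R) <= 1.
  move=> jl; rewrite divr_ge0 //=; have [->|l0] := posnP l.
    by rewrite invr0 mulr0.
  by rewrite ler_pdivrMr ?ltr0n// mul1r ler_nat.
have -> : \prod_(i < n) ((k i ^_ m i)%:R / (N ^_ m i)%:R) =
   \prod_(i < n) \prod_(j < m i) ((k i - j)%N%:R / (N - j)%N%:R) :> R.
  by apply: eq_bigr => i _; rewrite !ffact_prod !natr_prod -prodf_div.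
have -> : \prod_(i < n) ((k i)%:R / N%:R) ^+ m i =
   \prod_(i < n) \prod_(j < m i) ((k i)%:R / N%:R) :> R.
  by apply: eq_bigr => i _; rewrite prodr_const card_ord.
rewrite (le_trans (ler_norm_prodB _ _ _)) //.
- by move=> i; apply: prodr_itv01 => j; apply: ratio01; rewrite leq_sub2r.
- by move=> i; apply: prodr_itv01 => j; apply: ratio01.
apply: (@le_trans _ _ ((mdeg m)%:R * (d%:R / (N - d)%N%:R))); last first.
  by rewrite ler_wpM2r ?divr_ge0// ler_nat.
rewrite mdegE natr_sum mulr_suml; apply: ler_sum => i _.
rewrite (le_trans (ler_norm_prodB _ _ _)) //.
- by move=> j; apply: ratio01; rewrite leq_sub2r.
- by move=> j; apply: ratio01.
rewrite [leRHS](_ : _ = \sum_(j < m i) (d%:R / (N - d)%N%:R)); last first.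
  by rewrite sumr_const card_ord mulr_natl.
apply: ler_sum => j _.
by apply: ler_norm_ffact_ratio => //; rewrite ltnW // (leq_trans _ (mid i)).
Qed.

Lemma bernstein_coef_cvg p (e : R) : 0 < e ->
  exists N0, forall N (k : {ffun 'I_n -> 'I_N.+1}), (N0 <= N)%N ->
  `|bernstein_coef p k - p.@[bernstein_node k ord0]| <= e.
Proof.
move=> e0; set d := msize (p \mPo to_unit); set l := l1norm (p \mPo to_unit).
pose A := l * (d%:R * d%:R) / e.
have A0 : 0 <= A by rewrite divr_ge0 ?(ltW e0) ?mulr_ge0 ?l1norm_ge0.
exists (d + (Num.bound A).+1)%N => N k NN.
have dN : (d < N)%N by rewrite (leq_trans _ NN) // addnS ltnS leq_addr.
rewrite (le_trans (bernstein_coef_dist k (leqnn _) dN)) // -/l -/d.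
have Nd0 : 0 < (N - d)%N%:R :> R by rewrite ltr0n subn_gt0.
rewrite !mulrA ler_pdivrMr // -mulrA [e * _]mulrC -ler_pdivrMr // -/A.
rewrite (le_trans (ltW (archi_boundP A0))) // ler_nat.
by rewrite leq_subRL 1?ltnW // (leq_trans _ NN) // addnS.
Qed.

Lemma sos_limit_bernstein N (k : {ffun 'I_n -> 'I_N.+1}) :
  sos_limit (bernstein k).
Proof.
have l1 (i : 'I_n) : l1norm ('X_i : {mpoly R[n]}) <= 1 by rewrite l1normX.
have half (p : {mpoly R[n]}) : l1norm p <= 1 -> sos_limit (2^-1 *: (1 + p)).
  move=> p1; rewrite -mul_mpolyC; apply: sos_limitM; last exact: sos_limit1D.
  by apply: sos_limit_sos; apply: sosC; rewrite invr_ge0.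
apply: sos_limit_prod => i _; apply: sos_limitM.
  by apply: sos_limit_sos; rewrite -scaler_nat; apply: sosZ => //; apply: sos1.
by apply: sos_limitM; apply: sos_limitX; apply: half; rewrite ?l1normN.
Qed.

End BernsteinCube.

(** * Positive definite matrices *)

Section PositiveDefinite.
Variable (R : realType).

Definition quad_form m (C : 'M[R]_m) (y : 'rV[R]_m) : R :=
  \sum_i \sum_j C i j * (y ord0 i * y ord0 j).

Lemma quad_formE m (C : 'M[R]_m) y : quad_form C y = (y *m C *m y^T) ord0 ord0.
Proof.
rewrite mxE /quad_form exchange_big /=; apply: eq_bigr => j _.
by rewrite !mxE mulr_suml; apply: eq_bigr => i _; ring.
Qed.

Lemma quad_formD m (C D : 'M[R]_m) y :
  quad_form (C + D) y = quad_form C y + quad_form D y.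
Proof. by rewrite !quad_formE mulmxDr mulmxDl mxE. Qed.

Lemma quad_form_scalar m (c : R) (y : 'rV[R]_m) :
  quad_form c%:M y = c * \sum_i y ord0 i ^+ 2.
Proof.
rewrite quad_formE mul_mx_scalar -scalemxAl !mxE; congr (_ * _).
by apply: eq_bigr => i _; rewrite !mxE expr2.
Qed.

Lemma sum_sqr_gt0 m (y : 'rV[R]_m) : y != 0 -> 0 < \sum_i y ord0 i ^+ 2.
Proof.
move=> y0; rewrite lt_def sumr_ge0 ?andbT => [|i _]; last exact: sqr_ge0.
apply: contraNneq y0 => /eqP; rewrite psumr_eq0; last by move=> i _; apply: sqr_ge0.
move=> /allP y0; apply/eqP/rowP => i; rewrite mxE; apply/eqP.
by have := y0 i (mem_index_enum i); rewrite sqrf_eq0.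
Qed.

Lemma ler_norm_quad_form m (C : 'M[R]_m) (y : 'rV[R]_m) :
  `|quad_form C y| <= (\sum_i \sum_j `|C i j|) * \sum_k y ord0 k ^+ 2.
Proof.
rewrite (le_trans (ler_norm_sum _ _ _)) // mulr_suml; apply: ler_sum => i _.
rewrite (le_trans (ler_norm_sum _ _ _)) // mulr_suml; apply: ler_sum => j _.
rewrite normrM ler_wpM2l //.
have yk k : y ord0 k ^+ 2 <= \sum_l y ord0 l ^+ 2.
  by rewrite (bigD1 k) //= lerDl sumr_ge0 // => l _; apply: sqr_ge0.
have := yk i; have := yk j; set S := \sum_l _; move: (y _ i) (y _ j) => a b.
by move=> bS aS; rewrite ler_norml; apply/andP; split; nra.
Qed.

Definition pos_def m (C : 'M[R]_m) : Prop :=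
  C^T = C /\ forall y, y != 0 -> 0 < quad_form C y.

(** Cholesky factorization: the top left entry x is positive, and the Schur
    complement S of x is positive definite because its form at z is the form of C
    at the vector (- x^-1 z b^T, z). *)
Lemma pos_def_gram m (C : 'M[R]_m) : pos_def C -> exists V : 'M_m, C = V^T *m V.
Proof.
elim: m C => [|m IHm] C [symC posC].
  by exists 0; apply/matrixP => -[].
move: C symC posC; rewrite -[m.+1]/(1 + m)%N => C.
rewrite -[C]submxK; set a := ulsubmx C; set b := ursubmx C.
set b' := dlsubmx C; set D := drsubmx C.
rewrite tr_block_mx => /eq_block_mx [_ _ bb' symD]; rewrite -{}bb' => posC.
set x := a ord0 ord0; have ax : a = x%:M by apply: mx11_scalar.
have x0 : 0 < x.
  have := posC (row_mx 1 0); rewrite quad_formE mul_row_block !mul1mx !mul0mx.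
  rewrite !addr0 tr_row_mx mul_row_col trmx1 mulmx1 trmx0 mulmx0 addr0; apply.
  apply/eqP => /matrixP /(_ ord0 (lshift m ord0)); rewrite row_mxEl !mxE eqxx.
  by move/eqP; rewrite oner_eq0.
pose S := D - x^-1 *: (b^T *m b).
have [|W SW] := IHm S.
  split; first by rewrite /S linearB /= linearZ /= trmx_mul trmxK symD.
  move=> z z0; have := posC (row_mx (- x^-1 *: (z *m b^T)) z).
  rewrite !quad_formE mul_row_block tr_row_mx mul_row_col ax mul_mx_scalar.
  rewrite scalerA mulrN mulfV ?gt_eqF// scaleN1r addNr mul0mx add0r.
  rewrite /S mulmxBr -scalemxAr -!scalemxAl !scaleNr addrC mulmxA; apply.
  apply: contra_neq z0 => /(congr1 rsubmx).
  by rewrite row_mxKr raddf0.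
exists (block_mx (Num.sqrt x)%:M ((Num.sqrt x)^-1 *: b) 0 W).
have sx0 : Num.sqrt x != 0 by rewrite gt_eqF // sqrtr_gt0.
have sxx : Num.sqrt x * Num.sqrt x = x by rewrite -expr2 sqr_sqrtr // ltW.
rewrite tr_block_mx mulmx_block !tr_scalar_mx !trmx0 !mul0mx !mulmx0 !addr0.
rewrite -scalar_mxM sxx -ax mul_scalar_mx scalerA mulfV // scale1r.
have -> : ((Num.sqrt x)^-1 *: b)^T = (Num.sqrt x)^-1 *: b^T.
  by apply/matrixP => i j; rewrite !mxE.
rewrite mul_mx_scalar scalerA mulfV // scale1r -SW -scalemxAl -scalemxAr scalerA.
by rewrite -invfM sxx /S addrC subrK.
Qed.

Lemma pos_def_perturb m (C E : 'M[R]_m) (e : R) : 0 < e ->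
  C^T = C -> E^T = E -> (forall y, 0 <= quad_form C y) ->
  \sum_i \sum_j `|E i j| < e -> pos_def (C + E + e%:M).
Proof.
move=> e0 symC symE posC Ee; split; first by rewrite !raddfD /= symC symE tr_scalar_mx.
move=> y /sum_sqr_gt0 y0; rewrite !quad_formD quad_form_scalar -addrA.
rewrite ltr_wpDl // -ltrBlDl sub0r (le_lt_trans (ler_norm _)) // normrN.
by rewrite (le_lt_trans (ler_norm_quad_form _ _)) // ltr_pM2r.
Qed.

End PositiveDefinite.

(** * Matrices that are positive semidefinite on the cube *)

Section MatrixApproximation.
Variables (R : realType) (n m : nat).
Implicit Types (H : 'M[{mpoly R[n]}]_m).

Lemma sos_matrix_pos_def (C : 'M[R]_m) :
  pos_def C -> sos_matrix (map_mx (@mpolyC n R) C).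
Proof.
move=> /pos_def_gram [V ->]; rewrite map_mxM -[map_mx _ _^T]matrix.map_trmx.
exact: sos_matrix_gram.
Qed.

(** One half d of e makes the Bernstein coefficients C k of H + d I positive
    definite.  The other half pays for replacing each Bernstein polynomial B by
    the sum of squares B + b Theta_D: the excess b Theta_D * C k is completed to
    the scalar matrix b Theta_D * M k by the positive definite matrix
    M k I - C k. *)
Lemma sos_matrix_approx H : H^T = H ->
  (forall x : 'rV[R]_n, cube x -> forall y : 'rV[R]_m,
     0 <= \sum_i \sum_j (H i j).@[x ord0] * (y ord0 i * y ord0 j)) ->
  forall e : R, 0 < e -> exists D0, forall D, (D0 <= D)%N ->
    sos_matrix (H + (e *: even_powers R n D)%:M).
Proof.
move=> symH posH e e0.
pose d := e / 2; have d0 : 0 < d by rewrite divr_gt0.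
(* Entrywise errors t add up to at most m * m * t < d over the m x m matrix. *)
pose t := d / (m * m).+1%:R; have t0 : 0 < t by rewrite divr_gt0 ?ltr0n.
have [N [N0 NE NH]] : exists N, [/\ (0 < N)%N,
    forall i j, (msize (H i j \mPo to_unit R n) <= N)%N &
    forall i j (k : {ffun 'I_n -> 'I_N.+1}),
      `|bernstein_coef (H i j) k - (H i j).@[bernstein_node R k ord0]| <= t].
  have /choice [N1 N1P] (ij : 'I_m * 'I_m) := bernstein_coef_cvg (H ij.1 ij.2) t0.
  exists (\max_ij maxn (N1 ij) (msize (H ij.1 ij.2 \mPo to_unit R n))).+1.
  split=> // i j => [|k].
    rewrite ltnW // ltnS (leq_trans _ (leq_bigmax (i, j))) //=.
    by rewrite leq_maxr.
  apply: (N1P (i, j)); rewrite ltnW // ltnS (leq_trans _ (leq_bigmax (i, j))) //=.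
  by rewrite leq_maxl.
pose K := {ffun 'I_n -> 'I_N.+1}.
pose Cf (k : K) : 'M[R]_m := \matrix_(i, j) bernstein_coef (H i j) k.
pose C k := Cf k + d%:M.
have symCf k : (Cf k)^T = Cf k.
  by apply/matrixP => i j; rewrite !mxE -[in RHS]symH mxE.
have posC k : pos_def (C k).
  pose E : 'M[R]_m := \matrix_(i, j) (H i j).@[bernstein_node R k ord0].
  have symE : E^T = E by apply/matrixP => i j; rewrite !mxE -[in RHS]symH mxE.
  rewrite /C -[Cf k](subrKC E); apply: pos_def_perturb => //.
  - by rewrite linearB /= symE symCf.
  - move=> y; apply: le_trans (posH _ (cube_bernstein_node R k N0) y) _.
    by apply: ler_sum => i _; apply: ler_sum => j _; rewrite mxE.
  apply: (@le_lt_trans _ _ (\sum_(i < m) \sum_(j < m) t)).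
    by apply: ler_sum => i _; apply: ler_sum => j _; rewrite !mxE NH.
  rewrite !sumr_const !card_ord -mulrnA -[t *+ _]mulr_natr /t mulrAC.
  by rewrite ltr_pdivrMr ?ltr0n // ltr_pM2l // ltr_nat.
have HE : H + d%:MP%:M = \sum_(k : K) bernstein R k *: map_mx (@mpolyC n R) (C k).
  under eq_bigr do rewrite map_mxD scalerDr.
  rewrite big_split /=; congr (_ + _).
    apply/matrixP => i j; rewrite summxE [LHS](@bernsteinE _ _ N) //.
    by apply: eq_bigr => k _; rewrite !mxE mulrC mul_mpolyC.
  by rewrite -scaler_suml sum_bernstein scale1r map_scalar_mx.
pose M k : R := (\sum_i \sum_j `|C k i j|) + 1.
have M0 k : 0 < M k.
  by rewrite ltr_wpDl // sumr_ge0 // => i _; rewrite sumr_ge0.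
pose MC k : 'M[R]_m := (M k)%:M - C k.
have posMC k : pos_def (MC k).
  split=> [|y /sum_sqr_gt0 y0].
    by rewrite /MC linearB /= tr_scalar_mx (posC k).1.
  rewrite quad_formD quad_form_scalar -scaleN1r.
  have -> : quad_form (-1 *: C k) y = - quad_form (C k) y.
    by rewrite !quad_formE -scalemxAr -scalemxAl scaleN1r mxE.
  rewrite subr_gt0 (le_lt_trans (ler_norm _)) //.
  by rewrite (le_lt_trans (ler_norm_quad_form _ _)) // ltr_pM2r // ltrDl.
pose S : R := \sum_(k : K) M k.
have S0 : 0 < S.
  rewrite /S (bigD1 [ffun=> ord0]) //= ltr_pwDl // sumr_ge0 // => k _.
  exact: ltW.
pose b := d / S; have b0 : 0 < b by rewrite divr_gt0.
have /choice [D1 D1P] (k : K) :=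
  sos_limitD_even_powers (sos_limit_bernstein (R := R) k) b0.
exists (\max_(k : K) D1 k)%N => D DD; set P := even_powers R n D.
have HM : \sum_(k : K) (b *: P) *: map_mx (@mpolyC n R) (C k)
    + \sum_(k : K) (b *: P) *: map_mx (@mpolyC n R) (MC k) = (d *: P)%:M.
  rewrite -big_split /=.
  transitivity (\sum_(k : K) ((b *: P) * (M k)%:MP)%:M : 'M[{mpoly R[n]}]_m).
    apply: eq_bigr => k _; rewrite -scalerDr -map_mxD /MC addrC subrK.
    by rewrite map_scalar_mx scale_scalar_mx.
  rewrite -raddf_sum /= -mulr_sumr -raddf_sum /= -/S mulrC mul_mpolyC scalerA.
  by rewrite /b mulrC divfK ?gt_eqF.
have -> : H + (e *: P)%:M =
  \sum_(k : K) (bernstein R k + b *: P) *: map_mx (@mpolyC n R) (C k)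
  + \sum_(k : K) (b *: P) *: map_mx (@mpolyC n R) (MC k)
  + (d *: (P - 1))%:M.
  under eq_bigr do rewrite scalerDl.
  rewrite big_split /= -HE -[in RHS](addrA (H + _)) HM.
  rewrite -(addrA (H + _)) -(addrA H); congr (_ + _).
  rewrite -!(raddfD (@scalar_mx {mpoly R[n]} m)) /=; congr (_%:M).
  rewrite -[d%:MP]mulr1 mul_mpolyC scalerBr addrCA subrKC -scalerDl.
  by rewrite /d -splitr.
apply: sos_matrixD; first apply: sos_matrixD.
- apply: sos_matrix_sum => k _; apply: sos_matrixZ; last exact: sos_matrix_pos_def.
  by apply: D1P; rewrite (leq_trans _ DD) // (leq_bigmax k).
- apply: sos_matrix_sum => k _; apply: sos_matrixZ; last exact: sos_matrix_pos_def.
  by apply: sosZ; [apply: ltW | apply: sos_even_powers].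
- apply: sos_matrix_scalar; apply: sosZ; first exact: ltW.
  rewrite /P /even_powers addrC addKr.
  by apply: sos_sum => j _; apply: sosX_even.
Qed.

End MatrixApproximation.

(** * Perturbations with uniformly bounded l1-norm *)

(** Bernoulli's inequality, in the form (1 + t)^k (1 - k t) <= 1. *)
Lemma exprD1_le2 (R : realType) (t : R) k : 0 <= t -> k%:R * t <= 1 / 2 ->
  (1 + t) ^+ k <= 2.
Proof.
move=> t0 kt.
suff bern : (1 + t) ^+ k * (1 - k%:R * t) <= 1.
  have : (1 + t) ^+ k * (1 / 2) <= (1 + t) ^+ k * (1 - k%:R * t).
    by rewrite ler_wpM2l ?exprn_ge0 ?addr_ge0 //; lra.
  lra.
elim: k {kt} => [|k IHk]; first by rewrite expr0 mul0r subr0 mulr1.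
apply: le_trans IHk; rewrite exprSr -mulrA ler_wpM2l ?exprn_ge0 ?addr_ge0//.
rewrite -subr_ge0 (_ : _ - _ = k.+1%:R * t ^+ 2); last by rewrite -natr1; ring.
by rewrite mulr_ge0 ?sqr_ge0.
Qed.

Section Perturbation.
Variables (R : realType) (n : nat).
Implicit Types (p q : {mpoly R[n]}).

Lemma mderivXU i j : ('X_j : {mpoly R[n]})^`M(i) = (j == i)%:R.
Proof.
rewrite mderivX mnm1E; case: eqVneq => [->|_]; last by rewrite scale0r.
rewrite scale1r -mpolyX0; congr ('X_[_]).
by apply/mnmP => k; rewrite mnmBE subnn mnm0E.
Qed.

Lemma mderivXn k p N : (p ^+ N.+1)^`M(k) = N.+1%:R *: (p ^+ N * p^`M(k)).
Proof.
elim: N => [|N IHN]; first by rewrite expr1 expr0 mul1r scale1r.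
rewrite exprS mderivM IHN -[in RHS]natr1 scalerDl scale1r addrC exprS.
by rewrite -scalerAr; congr (_ *: _ + _); ring.
Qed.

(** The tangent inequality for an even power, without sign conditions on p and q:
    [sos_agm] for p^2 and q^2 bounds p^(2d) by a multiple of p^2 q^(2d-2), and
    (p - q)^2 linearizes p^2. *)
Lemma sos_tangent p q k :
  sos (p ^+ k.+1.*2 - (p * q ^+ k.*2.+1) *+ k.+1.*2 + q ^+ k.+1.*2 *+ k.*2.+1).
Proof.
have -> : p ^+ k.+1.*2 - (p * q ^+ k.*2.+1) *+ k.+1.*2 + q ^+ k.+1.*2 *+ k.*2.+1
  = ((p ^+ 2) ^+ k.+1 - (p ^+ 2 * (q ^+ 2) ^+ k) *+ k.+1 + (q ^+ 2) ^+ k.+1 *+ k)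
    + ((q ^+ 2) ^+ k * (p - q) ^+ 2) *+ k.+1.
  rewrite -!exprM !mul2n -!addnn !addnS !addSn !exprS; ring.
apply: sosD; first by apply: sos_agm; apply: sos_sqr.
by apply: sosMn; apply: sosM; [apply: sosX; apply: sos_sqr | apply: sos_sqr].
Qed.

(** Jensen's inequality: add the tangent inequalities at the mean of p and q. *)
Lemma sos_expr_convex p q (a b : R) k : 0 <= a -> 0 <= b -> a + b = 1 ->
  sos (a *: p ^+ k.+1.*2 + b *: q ^+ k.+1.*2 - (a *: p + b *: q) ^+ k.+1.*2).
Proof.
move=> a0 b0 ab; set c := a *: p + b *: q.
pose T r := r ^+ k.+1.*2 - (r * c ^+ k.*2.+1) *+ k.+1.*2 + c ^+ k.+1.*2 *+ k.*2.+1.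
have -> : a *: p ^+ k.+1.*2 + b *: q ^+ k.+1.*2 - c ^+ k.+1.*2 =
    a *: T p + b *: T q.
  have ab' : a%:MP + b%:MP = 1 :> {mpoly R[n]} by rewrite -mpolyCD ab.
  rewrite /T -!mul_mpolyC; set P := p ^+ _; set Q := q ^+ _.
  have cE : c = a%:MP * p + b%:MP * q by rewrite !mul_mpolyC.
  have -> : c ^+ k.+1.*2 = c * c ^+ k.*2.+1 by rewrite -exprS doubleS.
  set C := c ^+ k.*2.+1.
  transitivity (a%:MP * P + b%:MP * Q - (a%:MP * p + b%:MP * q) * C *+ k.+1.*2
     + (a%:MP + b%:MP) * (c * C) *+ k.*2.+1); last by ring.
  by rewrite -cE ab' doubleS; ring.
by apply: sosD; apply: sosZ => //; apply: sos_tangent.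
Qed.

(** Apply [sos_expr_convex] to p and - q with weights u = 1 / (1 + t) and u t, then
    multiply by E = (1 + t) ^+ k.+1.*2, which is at most 2. *)
Lemma sos_exprB p q (t : R) k : 0 <= t -> (1 + t) ^+ k.+1.*2 <= 2 ->
  sos (2 *: (p ^+ k.+1.*2 + q ^+ k.+1.*2) - (p - t *: q) ^+ k.+1.*2).
Proof.
move=> t0 t2; have t1 : 0 < 1 + t by lra.
set N := k.+1.*2; pose u := ((1 + t)^-1)%R.
have u0 : 0 <= u by rewrite invr_ge0 ltW.
have ut : u + u * t = 1 by rewrite -[X in X + _]mulr1 -mulrDr mulVf ?gt_eqF.
have u1 : u <= 1 by rewrite -ut lerDl mulr_ge0.
pose E := (1 + t) ^+ N; have E0 : 0 <= E by rewrite exprn_ge0 // ltW.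
have -> : 2 *: (p ^+ N + q ^+ N) - (p - t *: q) ^+ N =
  E *: (u *: p ^+ N + (u * t) *: (- q) ^+ N - (u *: p + (u * t) *: (- q)) ^+ N)
  + ((2 - E * u) *: p ^+ N + (2 - E * (u * t)) *: q ^+ N).
  have -> : u *: p + (u * t) *: (- q) = u *: (p - t *: q).
    by rewrite scalerBr scalerA scalerN.
  have -> : (- q) ^+ N = q ^+ N by rewrite /N -mul2n exprM sqrrN -exprM.
  have Eu : E * u ^+ N = 1 by rewrite -exprMn mulfV ?expr1n// gt_eqF.
  have split2 (P Q Z : {mpoly R[n]}) (a b c d : R) : a * d = 1 ->
      2 *: (P + Q) - Z = a *: (b *: P + c *: Q - d *: Z)
        + ((2 - a * b) *: P + (2 - a * c) *: Q).
    move=> ad; rewrite scalerBr !scalerDr !scalerA ad scale1r !scalerBl.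
    by move: (_ *: P) (_ *: Q) (_ *: P) (_ *: Q) => *; ring.
  by rewrite exprZn; apply: split2.
apply: sosD.
  apply: sosZ => //; apply: sos_expr_convex => //; exact: mulr_ge0.
have E2 v : 0 <= v -> v <= 1 -> 0 <= 2 - E * v.
  by move=> v0 v1; rewrite subr_ge0 -[leRHS]mulr1 ler_pM.
have ut0 : 0 <= u * t by rewrite mulr_ge0.
apply: sosD; apply: sosZ; try exact: sosX_even; apply: E2 => //.
by rewrite -ut lerDr.
Qed.

(** With X j = s j *: 'X_j and L i j = X j + t *: X i, the derivative along X k
    of the summand with indices k and j contains (N + 1) t L k j ^+ N, that is
    L k j ^+ N / 2, and (N + 1) X k ^+ N.  Since X j = L k j - t *: X k, four
    times their sum dominates X j ^+ N by [sos_exprB].  All the other terms of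
    the derivative are sums of squares, and the linear terms X j provide the
    constant. *)
Lemma monotone_perturbation (s : 'I_n -> R) D : (forall j, s j ^+ 2 = 1) ->
  exists2 h : {mpoly R[n]}, l1norm h <= n%:R + n%:R * (n%:R * 3) &
  forall k, sos (4 *: (s k *: h^`M(k)) - even_powers R n D.+1).
Proof.
move=> s1; have [N NE] : exists N, N = D.+1.*2 by exists D.+1.*2.
have [t [t0 Nt]] : exists t : R, 0 <= t /\ N.+1%:R * t = 1 / 2.
  exists ((2 * N.+1%:R)^-1)%R; split; first by rewrite invr_ge0 mulr_ge0.
  by field; rewrite addrC natr1 pnatr_eq0.
have sosN p : sos (p ^+ N) by rewrite NE; apply: sosX_even.
have sn j : `|s j| = 1.
  by apply/eqP; rewrite -(@eqrXn2 _ 2) ?normr_ge0 // expr1n real_normK ?num_real ?s1.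
pose X j : {mpoly R[n]} := s j *: 'X_j.
pose L i j := X j + t *: X i.
exists (\sum_j X j + \sum_i \sum_j (L i j ^+ N.+1 + X i ^+ N.+1)).
  have X1 j : l1norm (X j) = 1 by rewrite l1normZ sn l1normX mul1r.
  rewrite (le_trans (ler_l1normD _ _)) // lerD //.
    rewrite (le_trans (ler_l1norm_sum _ _ _)) //.
    by under eq_bigr do rewrite X1; rewrite sumr_const card_ord.
  rewrite (le_trans (ler_l1norm_sum _ _ _)) // mulr_natl -[X in _ *+ X]card_ord.
  rewrite -sumr_const; apply: ler_sum => i _.
  rewrite (le_trans (ler_l1norm_sum _ _ _)) // mulr_natl -[X in _ *+ X]card_ord.
  rewrite -sumr_const; apply: ler_sum => j _.
  rewrite (le_trans (ler_l1normD _ _)) // (_ : 3 = 2 + 1 :> R); last by ring.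
  rewrite lerD //; last first.
    by rewrite (le_trans (ler_l1normXn _ _)) // X1 expr1n.
  rewrite (le_trans (ler_l1normXn _ _)) // (@le_trans _ _ ((1 + t) ^+ N.+1)) //.
    rewrite lerXn2r ?nnegrE ?l1norm_ge0 ?addr_ge0 //.
    rewrite (le_trans (ler_l1normD _ _)) // X1 l1normZ X1 mulr1.
    by rewrite ger0_norm.
  by rewrite exprD1_le2 // Nt.
move=> k.
have dX j : s k *: (X j)^`M(k) = (j == k)%:R.
  rewrite mderivZ scalerA mderivXU; have [->|_] := eqVneq j k.
    by rewrite -expr2 s1 scale1r.
  by rewrite scaler0.
have dXN j M : s k *: (X j ^+ M.+1)^`M(k) = M.+1%:R *: ((j == k)%:R * X j ^+ M).
  by rewrite mderivXn scalerA mulrC -scalerA scalerAr dX mulrC.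
have dLN i j M : s k *: (L i j ^+ M.+1)^`M(k) =
    M.+1%:R *: (((j == k)%:R + t *: (i == k)%:R) * L i j ^+ M).
  rewrite mderivXn scalerA mulrC -scalerA scalerAr.
  have -> : s k *: (L i j)^`M(k) = (j == k)%:R + t *: (i == k)%:R.
    by rewrite mderivD (mderivZ k t) scalerDr dX scalerA [s k * t]mulrC -scalerA dX.
  by rewrite mulrC.
pose G i j := s k *: (L i j ^+ N.+1 + X i ^+ N.+1)^`M(k).
have GE i j : G i j = N.+1%:R *:
    (((j == k)%:R + t *: (i == k)%:R) * L i j ^+ N + (i == k)%:R * X i ^+ N).
  by rewrite /G mderivD scalerDr dLN dXN -scalerDr.
have natb_sos (b : bool) : sos (b%:R : {mpoly R[n]}).
  by case: b; [apply: sos1 | apply: sos0].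
have sosG i j : sos (G i j).
  rewrite GE; apply: sosZ => //; apply: sosD; apply: sosM => //.
  by apply: sosD => //; apply: sosZ.
have sosGk j : sos (4 *: G k j - 'X_j ^+ N).
  have XN : (L k j - t *: X k) ^+ N = 'X_j ^+ N.
    by rewrite addrK exprZn NE -mul2n [s j ^+ _]exprM s1 expr1n scale1r.
  pose c : R := 4 * N.+1%:R.
  have -> : 4 *: G k j = 2 *: (L k j ^+ N + X k ^+ N)
     + (c *: ((j == k)%:R * L k j ^+ N) + (c - 2) *: X k ^+ N).
    have ct : c * t = 2 by rewrite /c -mulrA Nt; field.
    rewrite GE eqxx mul1r scalerA -/c.
    move: (L k j ^+ N) (X k ^+ N) (j == k)%:R => P Q b.
    rewrite mulrDl -scalerAl !scalerDr scalerA ct scalerBl.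
    by rewrite mulr1n mul1r; move: (c *: _) (c *: _) (2 *: _) (2 *: _) => *; ring.
  rewrite addrAC; apply: sosD.
    rewrite -XN NE; apply: sos_exprB => //.
    rewrite -NE (le_trans _ (exprD1_le2 (k := N.+1) t0 _)) ?Nt//.
    by rewrite ler_weXn2l // lerDl.
  apply: sosD; first by apply: sosZ; [rewrite mulr_ge0 | apply: sosM].
  apply: sosZ => //.
  have : 1 <= N.+1%:R :> R by rewrite ler1n.
  by rewrite /c; lra.
have dh : s k *: (\sum_j X j + \sum_i \sum_j (L i j ^+ N.+1 + X i ^+ N.+1))^`M(k)
    = 1 + \sum_i \sum_j G i j.
  rewrite mderivD scalerDr; congr (_ + _).
    rewrite (raddf_sum (mderiv k)) scaler_sumr (eq_bigr _ (fun j _ => dX j)).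
    rewrite (bigD1 k) //= eqxx.
    by rewrite big1 ?addr0 // => j /negPf ->.
  rewrite (raddf_sum (mderiv k)) scaler_sumr; apply: eq_bigr => i _.
  by rewrite (raddf_sum (mderiv k)) scaler_sumr.
rewrite {}dh; clearbody G.
have -> : 4 *: (1 + \sum_i \sum_j G i j) - even_powers R n D.+1
  = (3 *: 1 + 4 *: (\sum_(i | i != k) \sum_j G i j))
    + \sum_j (4 *: G k j - 'X_j ^+ N).
  rewrite (bigD1 k) //= sumrB -scaler_sumr /even_powers -NE !scalerDr.
  have -> : (4 : R) *: (1 : {mpoly R[n]}) = 3 *: 1 + 1.
    by rewrite -[X in _ + X]scale1r -scalerDl; congr (_ *: _); ring.
  move: (3 *: 1) (\sum_(j < n) 'X_j ^+ N) (4 *: \sum_j G k j)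
    (4 *: \sum_(i | i != k) _) => a b c d.
  ring.
apply: sosD; first apply: sosD.
- by apply: sosZ => //; apply: sos1.
- by apply: sosZ => //; apply: sos_sum => i _; apply: sos_sum.
- by apply: sos_sum.
Qed.

End Perturbation.

Section ConvexPerturbation.
Variables (R : realType) (n : nat).
Implicit Types (p q : {mpoly R[n]}).

Definition gradient p : 'rV[{mpoly R[n]}]_n := \row_i p^`M(i).

Lemma hessianD p q : hessian (p + q) = hessian p + hessian q.
Proof. by apply/matrixP => i j; rewrite !mxE !mderivD. Qed.

Lemma hessianZ (c : R) p : hessian (c *: p) = c%:MP *: hessian p.
Proof. by apply/matrixP => i j; rewrite !mxE !mderivZ mul_mpolyC. Qed.

Lemma hessian_sum (I : Type) (r : seq I) (F : I -> {mpoly R[n]}) :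
  hessian (\sum_(i <- r) F i) = \sum_(i <- r) hessian (F i).
Proof.
elim: r => [|i r IHr]; last by rewrite !big_cons hessianD IHr.
by rewrite !big_nil; apply/matrixP => i j; rewrite !mxE !mderiv0.
Qed.

Lemma hessian_tr p : (hessian p)^T = hessian p.
Proof. by apply/matrixP => i j; rewrite !mxE mderiv_comm. Qed.

(** Both terms are sos matrices as soon as p is a sum of squares with an sos
    Hessian: this is why powers are used below. *)
Lemma hessianXn p N : hessian (p ^+ N.+2) =
  (N.+2 * N.+1)%:R%:MP * p ^+ N *: ((gradient p)^T *m gradient p)
  + (N.+2%:R%:MP * p ^+ N.+1) *: hessian p.
Proof.
apply/matrixP => i j; rewrite !mxE big_ord1 !mxE mderivXn mderivZ mderivM.
rewrite mderivXn scalerDr -!scalerAl scalerA -natrM -!mul_mpolyC.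
by rewrite !mulrA; congr (_ + _); rewrite -!mulrA [p^`M(j) * _]mulrC.
Qed.

Lemma hessian_sqr_var j : hessian ('X_j ^+ 2 : {mpoly R[n]}) = 2 *: delta_mx j j.
Proof.
rewrite hessianXn expr0 mulr1.
have -> : hessian ('X_j : {mpoly R[n]}) = 0.
  apply/matrixP => i k; rewrite !mxE mderivXU -mpolyC_nat; exact: mderivC.
rewrite scaler0 addr0; have -> : gradient ('X_j) = delta_mx ord0 j.
  by apply/rowP => i; rewrite !mxE mderivXU eq_sym.
by rewrite trmx_delta mul_delta_mx mpolyC_nat.
Qed.

Lemma hessian_norm2 : hessian (\sum_(k < n) 'X_k ^+ 2 : {mpoly R[n]}) = 2%:M.
Proof.
rewrite hessian_sum; under eq_bigr do rewrite hessian_sqr_var.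
by rewrite -scaler_sumr -mx1_sum_delta scale_scalar_mx mulr1.
Qed.

(** The Hessian of q j ^+ N is the sum of an sos matrix A j and of the scalar
    matrix 2 N t q j ^+ D.+1 coming from t |x|^2; here 2 N t = 1 / (n + 1), and
    q j ^+ D.+1 dominates the even power of x_j.  The term |x|^2 provides the
    constant. *)
Lemma convex_perturbation D :
  exists2 h : {mpoly R[n]}, l1norm h <= n%:R * 3 &
  sos_matrix (hessian (n.+1%:R *: h) - (even_powers R n D.+1)%:M).
Proof.
pose N := D.+2; have N0 : 0 < N%:R :> R by rewrite ltr0n.
have n0 : 0 < n.+1%:R :> R by rewrite ltr0n.
have [t [t0 Nt]] : exists t : R, 0 <= t /\ N%:R * (n.+1%:R * t) = 1 / 2.
  exists ((2 * n.+1%:R * N%:R)^-1)%R; split.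
    by rewrite invr_ge0 !mulr_ge0.
  by move: (N%:R : R) N0 (n.+1%:R : R) n0 => x x0 y y0; field; rewrite !gt_eqF.
pose S : {mpoly R[n]} := \sum_(k < n) 'X_k ^+ 2.
have lX j : l1norm ('X_j ^+ 2 : {mpoly R[n]}) <= 1.
  by rewrite (le_trans (ler_l1normXn _ _)) // l1normX expr1n.
have lS : l1norm S <= n%:R.
  rewrite (le_trans (ler_l1norm_sum _ _ _)) // -[leRHS]mulr_natl mulr1.
  by rewrite -[X in _ <= X%:R]card_ord -sumr_const; apply: ler_sum => j _.
pose q j := 'X_j ^+ 2 + t *: S.
have lq j : l1norm (q j ^+ N) <= 2.
  rewrite (le_trans (ler_l1normXn _ _)) //.
  apply: le_trans (@exprD1_le2 _ (n.+1%:R * t) N _ _); rewrite ?Nt ?mulr_ge0 //.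
  rewrite lerXn2r ?nnegrE ?l1norm_ge0 ?addr_ge0 ?mulr_ge0 //.
  rewrite (le_trans (ler_l1normD _ _)) // lerD // l1normZ ger0_norm // mulrC.
  by rewrite ler_wpM2r // (le_trans lS) // ler_nat.
exists (S + \sum_j q j ^+ N).
  rewrite (le_trans (ler_l1normD _ _)) // (_ : _ * 3 = n%:R + n%:R * 2); last by ring.
  rewrite lerD // (le_trans (ler_l1norm_sum _ _ _)) // mulr_natl.
  by rewrite -[X in _ *+ X]card_ord -sumr_const; apply: ler_sum => j _.
have sS : sos S by apply: sos_sum => j _; apply: sos_sqr.
have sq j : sos (q j) by apply: sosD; [apply: sos_sqr | apply: sosZ].
pose c : R := n.+1%:R.
pose A j := (N * D.+1)%:R%:MP * q j ^+ D *: ((gradient (q j))^T *m gradient (q j))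
  + (N%:R%:MP * q j ^+ D.+1) *: (2 *: delta_mx j j).
have Hq j : hessian (q j ^+ N) = A j + (N%:R%:MP * q j ^+ D.+1 * t%:MP * 2)%:M.
  rewrite hessianXn hessianD hessian_sqr_var hessianZ hessian_norm2.
  by rewrite scalerDr addrA !scale_scalar_mx mulrA.
have cN : c%:MP * (N%:R%:MP * t%:MP * 2) = 1 :> {mpoly R[n]}.
  rewrite -[2]/(2%:R) -mpolyC_nat -!mpolyCM; congr (_%:MP).
  by rewrite /c; move: Nt => /(congr1 ( *%R 2)); rewrite mulrA; lra.
have sA j : sos_matrix (A j).
  apply: sos_matrixD; apply: sos_matrixZ.
  - apply: sosM; last exact: sosX.
    by apply: sosC.
  - by exists 1%N, (gradient (q j)).
  - by apply: sosM; [apply: sosC | apply: sosX].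
  - apply: sos_matrixZ; first by rewrite -mpolyC_nat; apply: sosC.
    by rewrite -(mul_delta_mx (0 : 'I_1)) -trmx_delta; apply: sos_matrix_gram.
have -> : hessian (n.+1%:R *: (S + \sum_j q j ^+ N)) - (even_powers R n D.+1)%:M =
  c%:MP *: (\sum_j A j)
  + (c%:MP * 2 - 1 + \sum_j (q j ^+ D.+1 - 'X_j ^+ D.+1.*2))%:M.
  rewrite hessianZ hessianD hessian_norm2 hessian_sum (eq_bigr _ (fun j _ => Hq j)).
  have HQ : c%:MP *: \sum_j (N%:R%:MP * q j ^+ D.+1 * t%:MP * 2)%:M =
      (\sum_j q j ^+ D.+1)%:M :> 'M[{mpoly R[n]}]_n.
    rewrite scaler_sumr (raddf_sum (@scalar_mx _ n)); apply: eq_bigr => j _.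
    rewrite scale_scalar_mx; congr (_%:M).
    transitivity (c%:MP * (N%:R%:MP * t%:MP * 2) * q j ^+ D.+1); first by ring.
    by rewrite cN mul1r.
  rewrite big_split /= -/c !scalerDr HQ scale_scalar_mx addrCA -addrA.
  congr (_ + _); rewrite -(raddfD (@scalar_mx _ n)) -(raddfB (@scalar_mx _ n)) /=.
  congr (_%:M); rewrite sumrB /even_powers.
 by move: (\sum_j q j ^+ D.+1) (\sum_(j < n) 'X_j ^+ D.+1.*2) => *; ring.
apply: sos_matrixD.
  by apply: sos_matrixZ; [apply: sosC | apply: sos_matrix_sum].
apply: sos_matrix_scalar; apply: sosD.
  rewrite -[2]/(2%:R) -mpolyC_nat -mpolyC1 -mpolyCM -mpolyCB; apply: sosC.
  have : 1 <= c by rewrite /c ler1n.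
  lra.
apply: sos_sum => j _; rewrite -mul2n exprM; apply: sosXD_subX.
  exact: sos_sqr.
exact: sosZ.
Qed.

End ConvexPerturbation.

(** * The Hessian of a polynomial that is convex on the cube *)

Section Univariate.
Variable R : realType.
Implicit Types (p q : {poly R}).

Lemma horner_bounded p : exists2 B : R, 0 <= B & forall t, 0 <= t <= 1 -> `|p.[t]| <= B.
Proof.
elim/poly_ind: p => [|p c [B B0 IHp]].
  by exists 0 => // t _; rewrite horner0 normr0.
exists (B + `|c|) => [|t t01]; first by rewrite addr_ge0.
rewrite hornerMXaddC (le_trans (ler_normD _ _)) // lerD2r normrM.
rewrite -[leRHS]mulr1 ler_pM ?IHp //.
by case/andP: t01 => t0 t1; rewrite ger0_norm.
Qed.

(** Continuity at 0, in quantitative form: if q = r X + c with c < 0 and |r| <= B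
    on the unit interval, then q is negative at a small t > 0. *)
Lemma horner_ge0_limit q (d : R) : 0 < d ->
  (forall t, 0 < t < d -> 0 <= q.[t]) -> 0 <= q.[0].
Proof.
elim/poly_ind: q => [|q c _] d0 pos; first by rewrite horner0.
rewrite hornerMXaddC mulr0 add0r leNgt; apply/negP => c0.
have [B B0 qB] := horner_bounded q.
(* The last bound makes t * B smaller than - c. *)
pose t := Num.min (d / 2) (Num.min 1 (- c / (2 * (B + 1)))).
have B1 : 0 < 2 * (B + 1) by rewrite mulr_gt0 // ltr_wpDl.
have t0 : 0 < t by rewrite !lt_min ltr01 !divr_gt0 ?oppr_gt0.
have td : t < d by rewrite gt_min ltr_pdivrMr // mulr_natr mulr2n ltrDl d0.
have t1 : t <= 1 by rewrite !ge_min lexx orbT.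
have tc : t * (2 * (B + 1)) <= - c by rewrite -ler_pdivlMr // !ge_min lexx !orbT.
have := pos t; rewrite t0 td => /(_ isT); rewrite hornerMXaddC.
have := qB t; rewrite t1 ltW // => /(_ isT) /(le_trans (ler_norm _)) qt.
have : q.[t] * t <= B * t by rewrite ler_wpM2r // ltW.
nra.
Qed.

(** Writing p = r X^2 + c1 X + c0, the hypothesis says that r(t) + r(-t) is
    nonnegative for small t > 0, and the second derivative at 0 is 2 r(0). *)
Lemma deriv2_ge0 p (d : R) : 0 < d ->
  (forall t, 0 < t < d -> p.[0] *+ 2 <= p.[t] + p.[- t]) -> 0 <= p^`()^`().[0].
Proof.
elim/poly_ind: p => [|p c0 _]; first by rewrite deriv0 deriv0 horner0.
elim/poly_ind: p => [|r c1 _] d0 pos.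
  by rewrite mul0r add0r derivC deriv0 horner0.
have -> : ((r * 'X + c1%:P) * 'X + c0%:P)^`()^`().[0] = (r + (r \Po - 'X)).[0].
  rewrite !derivE !hornerE horner_comp !hornerE.
  by rewrite oppr0 /= addr0.
apply: (horner_ge0_limit d0) => t td; have t0 : 0 < t by case/andP: td.
have := pos t td; rewrite !hornerE horner_comp !hornerE /=.
rewrite -(@pmulr_rge0 _ (t * t)) ?mulr_gt0 //; lra.
Qed.

End Univariate.

Section LineRestriction.
Variables (R : realType) (n : nat).
Implicit Types (f g : {mpoly R[n]}) (x y : 'rV[R]_n).

(** The restriction of f to the line through x with direction y, as a univariate
    polynomial. *)
Definition line_poly x y f : {poly R} :=
  mmap (@polyC R) (fun i => (x ord0 i)%:P + y ord0 i *: 'X) f.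

Lemma horner_line_poly x y f t :
  (line_poly x y f).[t] = f.@[(x + t *: y) ord0].
Proof.
rewrite /line_poly /mmap horner_sum mevalE; apply: eq_bigr => m _.
rewrite hornerM hornerC /mmap1 horner_prod; congr (_ * _); apply: eq_bigr => i _.
by rewrite horner_exp !hornerE !mxE mulrC.
Qed.

(** The chain rule.  Both sides are derivations along the ring morphism
    [line_poly x y], so it is enough to compare them on the variables. *)
Lemma deriv_line_poly x y f :
  (line_poly x y f)^`() = \sum_i y ord0 i *: line_poly x y f^`M(i).
Proof.
have lineM g h : line_poly x y (g * h) = line_poly x y g * line_poly x y h.
  exact: rmorphM.
have lineD g h : line_poly x y (g + h) = line_poly x y g + line_poly x y h.
  exact: rmorphD.
have lineZ c g : line_poly x y (c *: g) = c *: line_poly x y g.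
  by rewrite /line_poly mmapZ mul_polyC.
pose P g := (line_poly x y g)^`() = \sum_i y ord0 i *: line_poly x y g^`M(i).
have PM g h : P g -> P h -> P (g * h).
  rewrite /P lineM derivM => -> ->; rewrite mulr_suml mulr_sumr -big_split /=.
  apply: eq_bigr => i _; rewrite mderivM lineD !lineM scalerDr -scalerAl.
  by rewrite -scalerAr.
have PU j : P 'X_j.
  rewrite /P {1}/line_poly mmapX mmap1U derivD derivC add0r derivZ derivX.
  rewrite (bigD1 j) //= big1 ?addr0 => [|i ij].
    by rewrite mderivXU eqxx /line_poly rmorph1.
  by rewrite mderivXU eq_sym (negPf ij) /line_poly raddf0 scaler0.
have P1 : P 1.
  rewrite /P /line_poly rmorph1 -polyC1 derivC big1 // => i _.
  by rewrite -mpolyC1 mderivC raddf0 scaler0.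
change (P f); elim/mpolyind: f => [|c m g _ _ Pg].
  rewrite /P /line_poly raddf0 deriv0 big1 // => i _.
  by rewrite mderiv0 raddf0 scaler0.
have Pm : P 'X_[m].
  by have [s _ ->] := mpolyX_prodU R m; apply: big_ind.
rewrite /P lineD lineZ derivD derivZ Pm Pg scaler_sumr -big_split /=.
apply: eq_bigr => i _; rewrite mderivD mderivZ lineD lineZ scalerDr.
by rewrite !scalerA mulrC.
Qed.

Lemma deriv2_line_poly x y f : (line_poly x y f)^`()^`().[0] =
  \sum_i \sum_j (hessian f i j).@[x ord0] * (y ord0 i * y ord0 j).
Proof.
rewrite deriv_line_poly raddf_sum /= horner_sum; apply: eq_bigr => i _.
rewrite derivZ hornerZ deriv_line_poly horner_sum mulr_sumr.
apply: eq_bigr => j _; rewrite hornerZ horner_line_poly scale0r addr0 mxE.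
by ring.
Qed.

Lemma convex_on_cube_midpoint f x y : convex_on_cube f -> cube (x + y) ->
  cube (x - y) -> f.@[x ord0] *+ 2 <= f.@[(x + y) ord0] + f.@[(x - y) ord0].
Proof.
move=> cf cxy cxy'.
have h0 : 0 <= (1 / 2 : R) by lra.
have h1 : (1 / 2 : R) <= 1 by lra.
have := cf (interval_inference.Itv01 h0 h1) (x + y) (x - y)
  (mem_set cxy) (mem_set cxy').
rewrite convRE /= /conv /= /unstable.onem.
have -> : 1 - 1 / 2 = 1 / 2 :> R by field.
have -> : (1 / 2) *: (x + y) + (1 / 2) *: (x - y) = x.
  rewrite -scalerDr addrACA subrr addr0 scalerDr -scalerDl.
  by rewrite (_ : 1 / 2 + 1 / 2 = 1 :> R) ?scale1r //; field.
lra.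
Qed.

(** At the interior point (1 - s) x the second differences of f in direction y are
    nonnegative; the boundary is reached by letting s tend to 0 in the quadratic
    form, which is polynomial in s. *)
Lemma convex_on_cube_hessian f : convex_on_cube f ->
  forall x, cube x -> forall y,
  0 <= \sum_i \sum_j (hessian f i j).@[x ord0] * (y ord0 i * y ord0 j).
Proof.
move=> cf x cx y.
pose q := \sum_i \sum_j (y ord0 i * y ord0 j) *: line_poly x (- x) (hessian f i j).
have qE t : q.[t] = \sum_i \sum_j (hessian f i j).@[((1 - t) *: x) ord0] *
    (y ord0 i * y ord0 j).
  rewrite horner_sum; apply: eq_bigr => i _; rewrite horner_sum.
  apply: eq_bigr => j _; rewrite hornerZ horner_line_poly mulrC.
  by rewrite scalerN scalerBl scale1r.
have := qE 0; rewrite subr0 scale1r => <-.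
apply: (@horner_ge0_limit _ _ 1) => // s /andP[s0 s1]; rewrite qE -deriv2_line_poly.
(* Moving by less than s / M along y stays within distance s of (1 - s) x. *)
pose M := 1 + \sum_i `|y ord0 i|.
have M0 : 0 < M by rewrite ltr_pwDl // sumr_ge0.
have yM i : `|y ord0 i| <= M.
  by rewrite /M (bigD1 i) //= addrCA lerDl addr_ge0 // sumr_ge0.
apply: (@deriv2_ge0 _ _ (s / M)); first by rewrite divr_gt0.
move=> t /andP[t0]; rewrite ltr_pdivlMr // => tM.
have cubet (e : R) : `|e| = t -> cube ((1 - s) *: x + e *: y).
  move=> et i; rewrite !mxE -ler_norml (le_trans (ler_normD _ _)) // !normrM et.
  have := yM i; have := cx i; rewrite -ler_norml (ger0_norm (_ : 0 <= 1 - s)); last lra.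
  move: `|x _ _| `|y _ _| => a b a1 bM.
  have : (1 - s) * a <= (1 - s) * 1 by rewrite ler_wpM2l //; lra.
  have : t * b <= t * M by rewrite ler_wpM2l // ltW.
  lra.
have := @convex_on_cube_midpoint f ((1 - s) *: x) (t *: y) cf.
rewrite !horner_line_poly scale0r addr0 scaleNr; apply.
  by apply: cubet; rewrite gtr0_norm.
by rewrite -scaleNr; apply: cubet; rewrite normrN gtr0_norm.
Qed.

End LineRestriction.

(** * Approximation by shape constrained polynomials *)

Section Approximation.
Variables (R : realType) (n : nat).
Implicit Types (f g : {mpoly R[n]}).

Lemma family_cvg (Q : {mpoly R[n]} -> Prop) f (C : R) :
  (forall e : R, 0 < e -> exists2 g, Q g & l1norm (f - g) <= e * C) ->
  exists F : R -> {mpoly R[n]}, (forall e, 0 < e -> Q (F e)) /\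
    (l1norm (f - F e) @[e --> (0 : R)^'+] --> (0 : R)).
Proof.
move=> approx.
have /choice [F FP] (e : R) : exists g, 0 < e -> Q g /\ l1norm (f - g) <= e * C.
  have [e0|e0] := boolP (0 < e); last by exists 0.
  by have [g Qg fg] := approx e e0; exists g.
exists F; split=> [e /FP[]//|].
apply: (@squeeze_cvgr _ _ _ _ (fun=> 0) (fun e => e * C)).
- near=> e; rewrite l1norm_ge0 /=; apply: (FP _ _).2.
  by near: e; exact: nbhs_right_gt.
- exact: cvg_cst.
- rewrite -[X in _ --> X](mul0r C); apply: cvgM; last exact: cvg_cst.
  apply: cvg_at_right_filter; exact: cvg_id.
Unshelve. all: by end_near.
Qed.

(** The multiple e (n + 1) of the perturbation is chosen so that its Hessian
    dominates the term e Theta_D I required by [sos_matrix_approx]. *)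
Lemma sos_convex_approx f : convex_on_cube f -> forall e : R, 0 < e ->
  exists2 g, sos_convex g & l1norm (f - g) <= e * (n.+1%:R * (n%:R * 3)).
Proof.
move=> cf e e0.
have [D DP] := sos_matrix_approx (hessian_tr f) (convex_on_cube_hessian cf) e0.
have [h hl hP] := convex_perturbation R n D.
exists (f + (e * n.+1%:R) *: h); last first.
  rewrite opprD addrA subrr sub0r l1normN l1normZ ger0_norm; last first.
    by rewrite mulr_ge0 // ltW.
  by rewrite mulrA ler_wpM2l // mulr_ge0 // ltW.
rewrite /sos_convex -scalerA hessianD hessianZ.
have -> : hessian f + e%:MP *: hessian (n.+1%:R *: h) =
    (hessian f + (e *: even_powers R n D.+1)%:M)
    + e%:MP *: (hessian (n.+1%:R *: h) - (even_powers R n D.+1)%:M).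
  rewrite scalerBr scale_scalar_mx mul_mpolyC [_ - _ in RHS]addrC addrA addrK.
  by [].
apply: sos_matrixD; first by apply: DP; rewrite leqnSn.
by apply: sos_matrixZ => //; apply: sosC; apply: ltW.
Qed.

Lemma sos_approx f : (forall x : 'rV[R]_n, cube x -> 0 <= f.@[x ord0]) ->
  forall e : R, 0 < e -> exists D0, forall D, (D0 <= D)%N ->
  sos (f + e *: even_powers R n D).
Proof.
move=> f0 e e0.
have [||D0 D0P] := @sos_matrix_approx R n 1 f%:M _ _ e e0.
- by rewrite tr_scalar_mx.
- by move=> x /f0 fx y; rewrite !big_ord1 mxE eqxx mulr1n mulr_ge0 // -expr2 sqr_ge0.
exists D0 => D /D0P sD; apply: sos_matrix1.
by rewrite (raddfD (@scalar_mx {mpoly R[n]} 1)).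
Qed.

(** Where rho vanishes the requirement on the derivative is void, but the variable
    still occurs in the other derivatives, whose perturbation has to dominate its
    even powers: there the sign s is set to 1. *)
Lemma sos_monotone_approx (rho : 'rV[R]_n) f :
  (forall i, rho ord0 i \in [:: -1; 0; 1]) -> monotone_on_cube rho f ->
  forall e : R, 0 < e -> exists2 g, sos_monotone rho g &
    l1norm (f - g) <= e * (4 * (n%:R + n%:R * (n%:R * 3))).
Proof.
move=> rho01 mf e e0.
have /choice [D0 D0P] (i : 'I_n) : exists D0, forall D, (D0 <= D)%N ->
    sos (rho ord0 i *: f^`M(i) + e *: even_powers R n D).
  by apply: sos_approx => // x cx; rewrite mevalZ; apply: mf.
pose s i := if rho ord0 i == 0 then 1 else rho ord0 i.
have rhoP i : rho ord0 i = 0 \/ rho ord0 i = s i /\ s i ^+ 2 = 1.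
  rewrite /s; have := rho01 i; rewrite !inE => /or3P[] /eqP ->.
  - by right; rewrite oppr_eq0 oner_eq0 sqrrN expr1n.
  - by left.
  - by right; rewrite oner_eq0 expr1n.
have s1 i : s i ^+ 2 = 1.
  have [r0|[_ //]] := rhoP i; by rewrite /s r0 eqxx expr1n.
pose D := (\max_i D0 i)%N.
have [h hl hP] := monotone_perturbation D s1.
exists (f + (e * 4) *: h); last first.
  rewrite opprD addrA subrr sub0r l1normN l1normZ ger0_norm; last first.
    by rewrite mulr_ge0 // ltW.
  by rewrite mulrA ler_wpM2l // mulr_ge0 // ltW.
move=> i; have [r0|[rs _]] := rhoP i; first by rewrite r0 scale0r; apply: sos0.
rewrite mderivD mderivZ scalerDr.
have -> : rho ord0 i *: ((e * 4) *: h^`M(i)) =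
    e *: even_powers R n D.+1
    + e *: (4 *: (s i *: h^`M(i)) - even_powers R n D.+1).
  by rewrite -scalerDr subrKC !scalerA rs mulrC.
rewrite addrA; apply: sosD; last by apply: sosZ; [apply: ltW | apply: hP].
by apply: D0P; rewrite ltnW // ltnS /D (leq_bigmax i).
Qed.

End Approximation.

Theorem corollary3p8 (R : realType) (n : nat) :
  (forall f : {mpoly R[n]}, convex_on_cube f ->
     exists F : R -> {mpoly R[n]},
       (forall eps : R, 0 < eps -> sos_convex (F eps)) /\
       (l1norm (f - F eps) @[eps --> (0 : R)^'+] --> (0 : R)))
  /\
  (forall rho : 'rV[R]_n, (forall i : 'I_n, rho ord0 i \in [:: -1; 0; 1]) ->
   forall f : {mpoly R[n]}, monotone_on_cube rho f ->
     exists F : R -> {mpoly R[n]},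
       (forall eps : R, 0 < eps -> sos_monotone rho (F eps)) /\
       (l1norm (f - F eps) @[eps --> (0 : R)^'+] --> (0 : R))).
Proof.
split=> [f cf|rho rho01 f mf]; apply: family_cvg.
  exact: sos_convex_approx.
exact: sos_monotone_approx.
Qed.
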